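(* Assume that $\mathrm S$ and $\mathbb U$ are compact. For each $r\in\mathbb N$ let $\mathbb P_r\in\mathcal P(\mathcal P(\mathbb X)\times\mathcal P(\mathbb X))$ be the empirical distribution associated with a data set $\mathcal D_r$, and assume that $\mathbb P_r\to\mathbb P$ weakly in $\mathcal P(\mathcal P(\mathbb X)\times\mathcal P(\mathbb X))$. Let $\underline U_r^*\in\mathbb U^T$ be a sequence of control actions optimal for $\mathbb P_r$, i.e. $V(\mathbb P_r,\underline U_r^* )=\inf_{\underline A\in\mathbb U^T}V(\mathbb P_r,\underline A)$, and let $\underline U^*\in\mathbb U^T$ be optimal for $\mathbb P$, i.e. $V^*(\mathbb P):=\inf_{\underline A\in\mathbb U^T}V(\mathbb P,\underline A)=V(\mathbb P,\underline U^* )$. Then $$V(\mathbb P,\underline U_r^* )\to V^*(\mathbb P)\qquad\text{as }r\to\infty.$$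
   Context: Fix integers $N,d,d_1,d_2,T\ge1$, $\beta>0$, $\lambda>0$. Let $\emptyset\ne\mathrm S\subset\mathbb R^d$, $p_i:=i/N$, $\mathrm{PE}_N:=\{p_1,\dots,p_N\}$, $\mathbb X:=\mathrm{PE}_N\times\mathrm S$. Let $\sigma:\mathbb R^{d_1}\to\mathbb R^{d_1}$ be $1$-Lipschitz. The action space $\mathbb U$ is a nonempty subset of $\mathbb R^{d\times d_1}\times\mathbb R^{d_1\times d}\times\mathbb R^{d_1}\times\mathbb R^{d_2\times d}\times\mathbb R^{d_2\times d}\times\mathbb R^{d\times d}$ with the Euclidean (product Frobenius) norm; its elements are written $U=(\mathsf W,\mathsf A,\mathsf b,\mathsf Q,\mathsf K,\mathsf V)$. $\mathcal P(\Omega)$ denotes the Borel probability measures on $\Omega$, with the topology of weak convergence (convergence against bounded continuous functions); $\mathcal P(\mathbb X)\times\mathcal P(\mathbb X)$ carries the product topology, and $\mathcal P(\mathcal P(\mathbb X)\times\mathcal P(\mathbb X))$ the corresponding weak convergence topology. For $\mu\in\mathcal P(\mathbb X)$, $\mu_{\mathrm S}$ is its marginal on $\mathrm S$. Define $f:\mathbb X\times\mathbb U\times\mathcal P(\mathbb X)\to\mathbb X$ by $$f((p,x),U,\mu):=\Big(p,\ \mathsf W\sigma(\mathsf Ax+\mathsf b)+\frac{\int_{\mathrm S}e^{\beta\langle\mathsf Qx,\mathsf Kz\rangle}\mathsf Vz\,\mu_{\mathrm S}(dz)}{\int_{\mathrm S}e^{\beta\langle\mathsf Qx,\mathsf Kz\rangle}\mu_{\mathrm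 S}(dz)}\Big);$$ it is a standing convention that $f$ is $\mathbb X$-valued. Let $\Phi(\mu,U):=\mu\circ f(\cdot,U,\mu)^{-1}$ (push-forward). For $\underline U=(U_0,\dots,U_{T-1})\in\mathbb U^T$ let $\Phi_T(\mu,\underline U)$ be the terminal measure $\mu_T$ of the recursion $\mu_0=\mu$, $\mu_{t+1}=\Phi(\mu_t,U_t)$, $t=0,\dots,T-1$. $W_{2,\lambda}(P,Q):=\big(\inf_\pi\int(\|x-y\|_2^2+\lambda|p-q|^2)\,\pi(d(p,x),d(q,y))\big)^{1/2}$ over couplings $\pi$ of $P,Q\in\mathcal P(\mathbb X)$. For $P\in\mathcal P(\mathcal P(\mathbb X)\times\mathcal P(\mathbb X))$ and $\underline U\in\mathbb U^T$, $$V(P,\underline U):=\int_{\mathcal P(\mathbb X)\times\mathcal P(\mathbb X)}W_{2,\lambda}(\Phi_T(\mu,\underline U),\nu)^2\,P(d\mu,d\nu).$$ A data set is $\mathcal D_r=\{(\mathbf x^{k,r},\mathbf y^{k,r}):k=1,\dots,K_r\}\subset\mathrm S^N\times\mathrm S^N$, and its empirical distribution is $\mathbb P_r:=\frac1{K_r}\sum_{k=1}^{K_r}\delta_{(\mu_0^{k,r},\nu^{k,r})}$ with $\mu_0^{k,r}:=\frac1N\sum_{i=1}^N\delta_{(p_i,x^{i,k,r})}$, $\nu^{k,r}:=\frac1N\sum_{i=1}^N\delta_{(p_i,y^{i,k,r})}$. *)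

(* Defs.v *)
From HB Require Import structures.
From mathcomp Require Import all_boot all_order all_algebra.
From mathcomp Require Import all_classical all_reals all_analysis.

Set Implicit Arguments.
Unset Strict Implicit.
Unset Printing Implicit Defensive.

Import Order.TTheory GRing.Theory Num.Theory.
Import numFieldNormedType.Exports.

Local Open Scope classical_set_scope.
Local Open Scope ring_scope.

(* The subspace topology on a nonempty set.  Measurable types are pointed in
   the library, so the proof of nonemptiness is a parameter of the type. *)
Definition subT {T : Type} {A : set T} (hA : A !=set0) : Type := A.

Definition subT_val {T : Type} {A : set T} {hA : A !=set0} (x : subT hA) : T :=
  @set_val T A x.

Definition subT_sub {T : Type} {A : set T} (hA : A !=set0) (x : T) (Ax : A x) :
  subT hA := exist _ x (mem_set Ax).

HB.instance Definition _ (T : topologicalType) (A : set T) (hA : A !=set0) :=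
  Topological.copy (subT hA) (set_type A).
HB.instance Definition _ (T : topologicalType) (A : set T) (hA : A !=set0) :=
  isPointed.Build (subT hA) (subT_sub hA (svalP (cid hA))).

HB.instance Definition _ (A B : ptopologicalType) := Pointed.on (A * B)%type.

Section Prob.
Variable R : realType.

(* [T] with its topology and its Borel sigma-algebra. *)
Definition borel (T : Type) : Type := T.

HB.instance Definition _ (T : ptopologicalType) :=
  PointedTopological.on (borel T).
HB.instance Definition _ (T : ptopologicalType) :=
  Measurable.copy (borel T) (g_sigma_algebraType (@open T)).

Definition bcfun (T : topologicalType) : Type :=
  {f : T -> R | continuous f /\ bounded_fun f}.
HB.instance Definition _ (T : topologicalType) := gen_eqMixin (bcfun T).
HB.instance Definition _ (T : topologicalType) := gen_choiceMixin (bcfun T).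

Definition bc_integrals (T : ptopologicalType) (mu : probability (borel T) R) :
    prod_topology (fun _ : bcfun T => R : topologicalType) :=
  fun f => \int[mu]_x (sval f x).

(* Borel probability measures with the topology of weak convergence, i.e. the
   initial topology of all the maps [mu |-> \int f dmu], [f] bounded
   continuous.  Two elements that agree on Borel sets are topologically
   indistinguishable but need not be Leibniz equal, as a measure of the library
   is a function on arbitrary sets. *)
Definition Prob (T : ptopologicalType) : Type :=
  initial_topology (@bc_integrals T).

HB.instance Definition _ (T : ptopologicalType) :=
  PointedTopological.on (Prob T).

Definition Prob_measure (T : ptopologicalType) (mu : Prob T) :
  probability (borel T) R := mu.
Coercion Prob_measure : Prob >-> Probability.type.

(* Image measure.  The fallback value, which makes the operation total, only
   concerns maps that are not Borel measurable. *)
Definition push (A B : ptopologicalType) (g : A -> B) (mu : Prob A) : Prob B :=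
  match pselect (measurable_fun setT (g : borel A -> borel B)) with
  | left mg => (distribution mu (mfun_Sub (mem_set mg)) : probability (borel B) R)
  | right _ => point
  end.

Section empirical.
Variables (T : ptopologicalType) (K : nat) (hK : (0 < K)%N) (x : 'I_K -> T).
Local Open Scope ereal_scope.

Definition empirical_measure of (0 < K)%N := fun (B : set (borel T)) =>
  (K%:R^-1)%R%:E * \sum_(k < K) (\d_(x k : borel T) B : \bar R).

Let dir (k : nat) : {measure set (borel T) -> \bar R} :=
  if insub k is Some i then \d_(x i : borel T) else mzero.

Let invK_ge0 : (0 <= K%:R^-1 :> R)%R.
Proof. by rewrite invr_ge0. Qed.

Let empE : empirical_measure hK = mscale (NngNum invK_ge0) (msum dir K).
Proof.
apply/funext => B; rewrite /empirical_measure /mscale /msum /=.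
by congr (_ * _); apply: eq_bigr => i _; rewrite /dir valK.
Qed.

Let emp0 : empirical_measure hK set0 = 0.
Proof. by rewrite empE measure0. Qed.

Let emp_ge0 B : 0 <= empirical_measure hK B.
Proof. by rewrite empE measure_ge0. Qed.

Let emp_sigma_additive : semi_sigma_additive (empirical_measure hK).
Proof. by rewrite empE; exact: measure_semi_sigma_additive. Qed.

HB.instance Definition _ := isMeasure.Build _ _ _ (empirical_measure hK)
  emp0 emp_ge0 emp_sigma_additive.

Let emp_setT : empirical_measure hK setT = 1.
Proof.
rewrite /empirical_measure; under eq_bigr do rewrite diracT.
rewrite sumEFin -EFinM sumr_const card_ord mulVf//.
by rewrite pnatr_eq0 -lt0n.
Qed.

HB.instance Definition _ :=
  Measure_isProbability.Build _ _ _ (empirical_measure hK) emp_setT.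

Definition empirical : Prob T := (empirical_measure hK : probability (borel T) R).

End empirical.

End Prob.

Section Euclidean.
Variable R : realType.

(* The norm and metric that the library puts on matrices are the sup ones; they
   give the Euclidean topology but not the Euclidean distances. *)
Definition dotp n (u v : 'cV[R]_n) : R := \sum_i u i 0 * v i 0.
Definition norm2 n (u : 'cV[R]_n) : R := Num.sqrt (dotp u u).

Definition lipschitz1 m n (g : 'cV[R]_m -> 'cV[R]_n) : Prop :=
  forall u v, norm2 (g u - g v) <= norm2 (u - v).

End Euclidean.

Section Transformer.
Variables (R : realType) (N d d1 d2 T : nat) (beta lambda : R).
Variable sigma : 'cV[R]_d1 -> 'cV[R]_d1.
Variables (S : set 'cV[R]_d) (hS : S !=set0).

(* p_1, ..., p_N, with indices shifted by one. *)
Definition position (i : 'I_N) : R := i.+1%:R / N%:R.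
Definition PE : set R := range position.

Lemma PE_position i : PE (position i).
Proof. by exists i. Qed.

Hypothesis hN : (0 < N)%N.

Lemma PE_nonempty : PE !=set0.
Proof. by exists (position (Ordinal hN)); exact: PE_position. Qed.

Definition XX : Type := (subT PE_nonempty * subT hS)%type.
HB.instance Definition _ :=
  PointedTopological.copy XX (subT PE_nonempty * subT hS)%type.

(* U = (W, A, b, Q, K, V) *)
Definition action : Type :=
  ('M[R]_(d, d1) * 'M[R]_(d1, d) * 'cV[R]_d1 *
   'M[R]_(d2, d) * 'M[R]_(d2, d) * 'M[R]_(d, d))%type.

(* [U] is only required to be in the ambient space here: that the values stay in
   [S] for admissible actions is [layer_stable]. *)
Definition layer (x : subT hS) (U : action) (mu : Prob R XX) : 'cV[R]_d :=
  let '(W, A, b, Q, K, V) := U in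
  let muS : Prob R (subT hS) := push (@snd _ _) mu in
  let x := subT_val x in
  let w (z : subT hS) := expR (beta * dotp (Q *m x) (K *m subT_val z)) in
  let v (z : subT hS) := V *m subT_val z in
  W *m sigma (A *m x + b) +
  (\int[muS]_z w z)^-1 *: \col_i \int[muS]_z (w z * v z i 0).

Variable UU : set action.

Definition layer_stable : Prop :=
  forall (x : subT hS) (U : action) (mu : Prob R XX), UU U -> S (layer x U mu).

Hypothesis hf : layer_stable.

Definition layer_map (z : XX) (U : UU) (mu : Prob R XX) : XX :=
  (z.1, subT_sub hS (hf z.2 mu (set_valP U))).

(* Every map [fun z => layer_map z U mu] is Borel measurable when [sigma] is
   Lipschitz, so [push] never takes its fallback value here. *)
Definition Phi (mu : Prob R XX) (U : UU) : Prob R XX :=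
  push (fun z => layer_map z U mu) mu.

Definition PhiT (mu : Prob R XX) (U : T.-tuple UU) : Prob R XX := foldl Phi mu U.

Definition couplings (P Q : Prob R XX) : set (Prob R (XX * XX)%type) :=
  [set pi | forall B : set (borel XX), measurable B ->
     pi (fst @^-1` B) = P B /\ pi (snd @^-1` B) = Q B].

Definition cost (z : XX * XX) : R :=
  norm2 (subT_val z.1.2 - subT_val z.2.2) ^+ 2
  + lambda * `|subT_val z.1.1 - subT_val z.2.1| ^+ 2.

Local Open Scope ereal_scope.

Definition W2 (P Q : Prob R XX) : \bar R :=
  poweR (ereal_inf [set \int[pi]_z (cost z)%:E | pi in couplings P Q]) (2^-1).

Definition value (P : Prob R (Prob R XX * Prob R XX)%type) (U : T.-tuple UU) :
    \bar R :=
  \int[P]_z (W2 (PhiT z.1 U) z.2 ^+ 2).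

Definition opt_value (P : Prob R (Prob R XX * Prob R XX)%type) : \bar R :=
  ereal_inf (range (value P)).

(* The pairs are indexed, so that a pair may be repeated. *)
Record dataset := Dataset {
  data_size : nat;
  data_size_gt0 : (0 < data_size)%N;
  data_input : 'I_data_size -> 'I_N -> subT hS;
  data_output : 'I_data_size -> 'I_N -> subT hS }.

Definition token_measure (x : 'I_N -> subT hS) : Prob R XX :=
  empirical R hN (fun i => (subT_sub PE_nonempty (PE_position i), x i) : XX).

Definition data_distribution (D : dataset) :
    Prob R (Prob R XX * Prob R XX)%type :=
  empirical R (data_size_gt0 D)
    (fun k => (token_measure (data_input k), token_measure (data_output k))).

End Transformer.

(* Main.v *)
(* Compactness of the space of measures is avoided by transporting everything to
   token matrices.  The pairs of measures that are uniform on N tokens, one at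
   each position, form a closed set, the zero set of a nonnegative
   continuous function [defect] (a variance at each position), which carries
   every empirical distribution and therefore also the weak limit.  On it, a
   measure is recovered from its barycenters, which depend continuously on it,
   a layer acts as a map of token matrices jointly continuous in the control, and
   the squared Wasserstein distance is an infimum over transport plans of finite
   size.  Hence the integrand of the value is a bounded function that is jointly
   continuous in the control and the measures; compactness of the token set makes
   it equicontinuous in the control, and compactness of the control set turns weak
   convergence into convergence of the values uniformly over the controls. *)
Require Import Defs.
From HB Require Import structures.
From mathcomp Require Import all_boot all_order all_algebra.
From mathcomp Require Import all_classical all_reals all_analysis.
From mathcomp Require Import measurable_realfun lra ring.

Set Implicit Arguments.
Unset Strict Implicit.
Unset Printing Implicit Defensive.

Import Order.TTheory GRing.Theory Num.Theory.
Import numFieldNormedType.Exports.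

Local Open Scope classical_set_scope.
Local Open Scope ring_scope.

(** * Borel sets and continuous maps *)

Section BorelContinuous.
Variable R : realType.

Lemma borel_open (T : ptopologicalType) (A : set T) :
  open A -> measurable (A : set (borel T)).
Proof. by move=> oA; apply: sub_sigma_algebra. Qed.

Lemma borel_closed (T : ptopologicalType) (A : set T) :
  closed A -> measurable (A : set (borel T)).
Proof.
move=> cA; rewrite -(setCK (A : set (borel T))); apply: measurableC.
by apply: borel_open; rewrite openC.
Qed.

Lemma continuous_borel (A B : ptopologicalType) (f : A -> B) :
  continuous f -> measurable_fun setT (f : borel A -> borel B).
Proof.
move=> /continuousP cf; apply: (@measurability _ _ (borel A) (borel B) setT f open) => //.
move=> _ [U oU <-]; rewrite setTI; apply: borel_open; exact: cf.
Qed.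

Lemma continuous_borelR (T : ptopologicalType) (f : T -> R) :
  continuous f -> measurable_fun setT (f : borel T -> R).
Proof.
move=> /continuousP cf.
apply: (measurability _ (RGenOpens.measurableE R)).
move=> _ [_ [a [b -> <-]]]; rewrite setTI; apply: borel_open; apply: cf.
exact: interval_open.
Qed.

End BorelContinuous.

(** * Finitely supported measures *)

Definition atomic (R : realType) (T : ptopologicalType) (I : finType)
     (mu : Prob R T) (w : I -> R) (a : I -> T) :=
  forall B : set (borel T), measurable B ->
    mu B = (\sum_i w i * \1_B (a i))%:E.

Section Atoms.
Variables (R : realType) (T : ptopologicalType).

Section Construction.
Variables (I : finType) (w : I -> R) (a : I -> T).
Hypotheses (w0 : forall i, 0 <= w i).

(** [msum] adds measures indexed by natural numbers, so [I] is enumerated; the filler [mzero] is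
    never reached by indices below [#|I|]. *)
Let dir (k : nat) : {measure set (borel T) -> \bar R} :=
  if insub k is Some i then mscale (NngNum (w0 (@enum_val I I i))) \d_(a (enum_val i) : borel T)
  else mzero.

Definition atoms of (forall i, 0 <= w i) : set (borel T) -> \bar R :=
  msum dir #|I|.

Lemma atomsE (B : set (borel T)) :
  atoms w0 B = (\sum_i w i * \1_B (a i))%:E.
Proof.
rewrite /atoms /msum -sumEFin (reindex _ (onW_bij _ (@enum_val_bij I))).
by apply: eq_bigr => i _; rewrite /dir valK /mscale/= /dirac EFinM.
Qed.

Let atoms0 : atoms w0 set0 = 0%E.
Proof. exact: measure0. Qed.

Let atoms_ge0 B : (0 <= atoms w0 B)%E.
Proof. exact: measure_ge0. Qed.

Let atoms_sigma_additive : semi_sigma_additive (atoms w0).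
Proof. exact: measure_semi_sigma_additive. Qed.

HB.instance Definition _ := isMeasure.Build _ _ _ (atoms w0)
  atoms0 atoms_ge0 atoms_sigma_additive.

Lemma integral_atoms (f : T -> \bar R) : measurable_fun setT (f : borel T -> \bar R) ->
  (forall x, 0 <= f x)%E ->
  (\int[atoms w0]_x f x = \sum_i (w i)%:E * f (a i))%E.
Proof.
move=> mf f0; rewrite /atoms ge0_integral_measure_sum//.
rewrite (reindex _ (onW_bij _ (@enum_val_bij I))).
apply: eq_bigr => i _; rewrite /dir valK ge0_integral_mscale//.
by rewrite integral_dirac// diracT mul1e.
Qed.

Hypothesis w1 : \sum_i w i = 1.

Let atomsT : atoms w0 setT = 1%E.
Proof.
rewrite atomsE; under eq_bigr do rewrite indicT mulr1.
by rewrite w1.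
Qed.

Lemma atomic_exists : exists mu : Prob R T, atomic mu w a.
Proof.
pose B := Measure_isProbability.Build _ _ _ (atoms w0) atomsT.
pose mu : probability (borel T) R := HB.pack (atoms w0) B.
by exists (mu : Prob R T) => C mC; rewrite -atomsE.
Qed.

End Construction.

Section Integral.
Variables (I : finType) (mu : Prob R T) (w : I -> R) (a : I -> T).
Hypotheses (w0 : forall i, 0 <= w i) (mua : atomic mu w a).

(** An integral only sees the values of the measure on Borel sets, so [mu] may be replaced by the
    explicit sum of Dirac masses [atoms w0]. *)
Lemma atomic_integral (f : T -> \bar R) : measurable_fun setT (f : borel T -> \bar R) ->
  (forall x, 0 <= f x)%E ->
  (\int[mu]_x f x = \sum_i (w i)%:E * f (a i))%E.
Proof.
move=> mf f0; rewrite -(integral_atoms a w0)//.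
by apply: eq_measure_integral => A mA _; rewrite [RHS]atomsE; exact: mua.
Qed.

Lemma atomic_Rintegral (f : T -> R) : continuous f ->
  \int[mu]_x f x = \sum_i w i * f (a i).
Proof.
move=> /continuous_borelR mf; rewrite /Rintegral integralE.
rewrite !atomic_integral//; last 2 first.
- by apply: measurable_funeneg; exact/measurable_EFinP.
- by apply: measurable_funepos; exact/measurable_EFinP.
have E (g : T -> \bar R) : (forall x, g x \is a fin_num) ->
    (\sum_i (w i)%:E * g (a i) = (\sum_i w i * fine (g (a i)))%:E)%E.
  by move=> fg; rewrite -sumEFin; apply: eq_bigr => i _; rewrite EFinM fineK.
rewrite !E /=; last 2 first.
- by move=> x; rewrite (funerneg f).
- by move=> x; rewrite (funerpos f).
rewrite -sumrB; apply: eq_bigr => i _; rewrite -mulrBr; congr (_ * _).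
rewrite (funerpos f) (funerneg f)/= /funrpos /funrneg /Num.max.
by do 2 case: ltP => ?; lra.
Qed.

Lemma atomic_push (A : ptopologicalType) (g : T -> A) :
  measurable_fun setT (g : borel T -> borel A) -> atomic (push g mu) w (g \o a).
Proof.
move=> mg B mB; rewrite /push; case: pselect => // mg'.
have := mua (measurable_sfunP (mfun_Sub (mem_set mg')) mB).
by [].
Qed.

End Integral.

End Atoms.

(** Up to a null set, [B] is the union of the finitely many pieces of [B] in the singletons
    [[set a i]], which are disjoint because [a] is injective. Each piece is empty or the whole
    singleton. *)
Lemma concentrated_atomic (R : realType) (T : ptopologicalType) (I : finType)
    (mu : Prob R T) (a : I -> T) : injective a ->
  (forall i, closed [set a i]) -> mu (~` range a) = 0%E ->
  atomic mu (fun i => fine (mu [set a i])) a.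
Proof.
move=> inj ca mu0 B mB.
have m1 i : measurable ([set a i] : set (borel T)) by exact: borel_closed.
have mra : measurable (range a : set (borel T)).
  rewrite -bigcup_imset1; apply: fin_bigcup_measurable; first exact: finite_finset.
  by move=> i _; exact: m1.
transitivity (mu (\bigcup_(i in [set: I]) (B `&` [set a i]))).
  rewrite -setI_bigcupr bigcup_imset1.
  rewrite -[in LHS](setIT B) -(setUv (range a)) setIUr measureU//.
  - rewrite [X in (_ + X)%E](_ : _ = 0%E) ?adde0//.
    apply/eqP; rewrite eq_le measure_ge0 andbT -mu0.
    apply: le_measure; rewrite ?inE//.
    + by apply: measurableI => //; exact: measurableC.
    + exact: measurableC.
  - exact: measurableI.
  - by apply: measurableI => //; exact: measurableC.
  - by rewrite setIACA setICr setI0.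
rewrite measure_fin_bigcup//; last 3 first.
- exact: finite_finset.
- by move=> i j _ _ [x [[_ /= ->] [_ /= /inj]]].
- by move=> i _; exact: measurableI.
rewrite -sumEFin (_ : [set: I] = [set` index_enum I]); last first.
  by apply/seteqP; split => // i _; rewrite /= mem_index_enum.
rewrite -fsbig_seq ?index_enum_uniq//; apply: eq_bigr => i _.
rewrite indicE; case: (boolP (a i \in B)) => aiB.
  rewrite mulr1 fineK ?fin_num_measure//; congr (Prob_measure mu _).
  by apply/seteqP; split => [x []//|x /= ->]; split => //; exact: set_mem.
rewrite mulr0; rewrite (_ : _ `&` _ = set0) ?measure0//.
by apply/seteqP; split => // x [+ xa]; rewrite xa => /mem_set; rewrite (negbTE aiB).
Qed.

(** * Continuity rules for real and matrix-valued maps, subspaces and products *)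

Section RealContinuity.
Variables (R : realType) (T : topologicalType).
Implicit Types f g : T -> R.

Lemma rcontD f g : continuous f -> continuous g -> continuous (fun t => f t + g t).
Proof. by move=> cf cg t; apply: cvgD; [exact: cf|exact: cg]. Qed.

Lemma rcontB f g : continuous f -> continuous g -> continuous (fun t => f t - g t).
Proof. by move=> cf cg t; apply: cvgB; [exact: cf|exact: cg]. Qed.

Lemma rcontM f g : continuous f -> continuous g -> continuous (fun t => f t * g t).
Proof. by move=> cf cg t; apply: cvgM; [exact: cf|exact: cg]. Qed.

Lemma rcont_cst (c : R) : continuous (fun _ : T => c).
Proof. by move=> t; exact: cvg_cst. Qed.

Lemma rcontX f n : continuous f -> continuous (fun t => f t ^+ n).
Proof.
move=> cf; elim: n => [|n IH].
  by under eq_fun do rewrite expr0; exact: rcont_cst.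
by under eq_fun do rewrite exprS; exact: rcontM.
Qed.

Lemma rcont_sum (I : Type) (s : seq I) (F : I -> T -> R) :
  (forall i, continuous (F i)) -> continuous (fun t => \sum_(i <- s) F i t).
Proof.
move=> cF; elim: s => [|i s IH].
  by under eq_fun do rewrite big_nil; exact: rcont_cst.
by under eq_fun do rewrite big_cons; exact: rcontD.
Qed.

Lemma rcontV f : (forall t, f t != 0) -> continuous f -> continuous (fun t => (f t)^-1).
Proof. by move=> f0 cf t; apply: cvgV; [exact: f0|exact: cf]. Qed.

Lemma rcont_expR f : continuous f -> continuous (fun t => expR (f t)).
Proof. by move=> cf t; exact: (@continuous_comp T R R f expR t (cf t) (@continuous_expR R _)). Qed.

Lemma rcont_norm f : continuous f -> continuous (fun t => `|f t|).
Proof.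
by move=> cf t; exact: (@continuous_comp T R R f Num.norm t (cf t) (@norm_continuous R R _)).
Qed.

Lemma rcont_min f g : continuous f -> continuous g ->
  continuous (fun t => Num.min (f t) (g t)).
Proof. by move=> cf cg t; apply: continuous_min; [exact: cf|exact: cg]. Qed.

Lemma rcont_max f g : continuous f -> continuous g ->
  continuous (fun t => Num.max (f t) (g t)).
Proof. by move=> cf cg t; apply: continuous_max; [exact: cf|exact: cg]. Qed.

Lemma mx_continuous m n (F : T -> 'M[R]_(m, n)) :
  (forall i j, continuous (fun t => F t i j)) -> continuous F.
Proof.
move=> cF t A [B FB BA]; near=> s; apply: BA => i j; move: i j; near: s.
apply: filter_forall => i; apply: filter_forall => j.
exact: (cF i j t _ (FB i j)).
Unshelve. all: by end_near. Qed.

End RealContinuity.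

Lemma comp_cont (A B C : topologicalType) (f : A -> B) (g : B -> C) :
  continuous f -> continuous g -> continuous (g \o f).
Proof. by move=> cf cg x; apply: cvg_comp; [exact: cf|exact: cg]. Qed.

Lemma subT_val_continuous (T : topologicalType) (A : set T) (hA : A !=set0) :
  continuous (@subT_val T A hA).
Proof. exact: initial_continuous. Qed.

Lemma subT_val_inj (T : Type) (A : set T) (hA : A !=set0) : injective (@subT_val T A hA).
Proof. exact: val_inj. Qed.

Lemma subT_sub_continuous (W T : topologicalType) (A : set T) (hA : A !=set0)
   (f : W -> T) (Af : forall w, A (f w)) :
  continuous f -> continuous (fun w => subT_sub hA (Af w)).
Proof.
move=> /continuousP cf; apply/continuousP => B [C oC <-].
exact: cf.
Qed.

Lemma fst_cont (A B : topologicalType) : continuous (@fst A B).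
Proof. by move=> x; exact: cvg_fst. Qed.

Lemma snd_cont (A B : topologicalType) : continuous (@snd A B).
Proof. by move=> x; exact: cvg_snd. Qed.

Lemma pair_cont (A B C : topologicalType) (f : A -> B) (g : A -> C) :
  continuous f -> continuous g -> continuous (fun x => (f x, g x)).
Proof. by move=> cf cg x; apply: cvg_pair; [exact: cf|exact: cg]. Qed.

(** * Token configurations and their uniform measures *)

Section Tokens.
Variables (R : realType) (N d : nat) (S : set 'cV[R]_d) (hS : S !=set0).
Hypothesis hN : (0 < N)%N.
Local Notation X := (XX hS hN).

Lemma position_inj : injective (@position R N).
Proof.
move=> i j /(congr1 (fun r => r * N%:R)); rewrite !divfK ?pnatr_eq0 -?lt0n//.
by move=> /eqP; rewrite eqr_nat => /eqP [] /val_inj.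
Qed.

Definition token (x : 'I_N -> subT hS) (i : 'I_N) : X :=
  (subT_sub (PE_nonempty R hN) (PE_position R i), x i).

Lemma token_inj x : injective (token x).
Proof. by move=> i j /(congr1 (fun z : X => subT_val z.1)) /position_inj. Qed.

(** A point is determined by its position and its token vector, both continuous with values in
    Hausdorff spaces. Closed singletons make point masses meaningful for Borel measures, as
    [concentrated_atomic] requires. *)
Lemma closed_set1X (z : X) : closed [set z].
Proof.
have -> : [set z] = (fun z' : X => subT_val z'.1) @^-1` [set subT_val z.1] `&`
                   (fun z' : X => subT_val z'.2) @^-1` [set subT_val z.2].
  apply/seteqP; split => [_ -> //|[p x] []/=].
  by case: z => q y /= /subT_val_inj -> /subT_val_inj ->.
apply: closedI; apply: closed_comp.
- by move=> ? _; apply: comp_cont; [exact: fst_cont|exact: subT_val_continuous].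
- by apply: accessible_closed_set1; apply: hausdorff_accessible; exact: Rhausdorff.
- by move=> ? _; apply: comp_cont; [exact: snd_cont|exact: subT_val_continuous].
- by apply: accessible_closed_set1; apply: hausdorff_accessible; exact: norm_hausdorff.
Qed.

Lemma Xpos_continuous : continuous (fun z : X => subT_val z.1).
Proof.
exact: (comp_cont (@fst_cont (subT (PE_nonempty R hN)) (subT hS)) (@subT_val_continuous _ _ _)).
Qed.

Lemma Xtok_continuous : continuous (fun z : X => subT_val z.2).
Proof.
exact: (comp_cont (@snd_cont (subT (PE_nonempty R hN)) (subT hS)) (@subT_val_continuous _ _ _)).
Qed.

Lemma Xcoord_continuous k : continuous (fun z : X => subT_val z.2 k 0).
Proof. exact: (comp_cont Xtok_continuous (@coord_continuous R d 1 k 0)). Qed.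

(** A predicate instead of an equation with a token measure: push-forwards and weak limits are
    identified on Borel sets only, which does not give Leibniz equality. *)
Definition is_tokens (mu : Prob R X) (x : 'I_N -> subT hS) :=
  atomic mu (fun=> N%:R^-1) (token x).

End Tokens.

(** * Wasserstein distance between token measures as finite optimal transport *)

Section Transport.
Variables (R : realType) (N d : nat) (S : set 'cV[R]_d) (hS : S !=set0).
Variables (lambda : R).
Hypotheses (hN : (0 < N)%N) (hlambda : 0 < lambda).
Local Notation X := (XX hS hN).

Lemma dotp_ge0 n (u : 'cV[R]_n) : 0 <= dotp u u.
Proof. by apply: sumr_ge0 => i _; rewrite -expr2 sqr_ge0. Qed.

Lemma norm2_sqr n (u : 'cV[R]_n) : norm2 u ^+ 2 = \sum_i u i 0 ^+ 2.
Proof.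
by rewrite /norm2 sqr_sqrtr ?dotp_ge0//; apply: eq_bigr => i _; rewrite expr2.
Qed.

(** Configurations are placed in the ambient matrix space because barycenters of arbitrary measures
    live there, even when their columns leave [S]. *)
Definition token_mx (x : 'I_N -> subT hS) : 'M[R]_(d, N) :=
  \matrix_(k, i) subT_val (x i) k 0.

Definition pair_cost (x y : 'M[R]_(d, N)) (ij : 'I_N * 'I_N) : R :=
  \sum_k (x k ij.1 - y k ij.2) ^+ 2
  + lambda * `|position R ij.1 - position R ij.2| ^+ 2.

Lemma pair_cost_ge0 x y ij : 0 <= pair_cost x y ij.
Proof.
apply: addr_ge0; first by apply: sumr_ge0 => k _; exact: sqr_ge0.
by rewrite mulr_ge0 ?sqr_ge0// ltW.
Qed.

Lemma cost_token x y i j : cost lambda (token hN x i, token hN y j) =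
  pair_cost (token_mx x) (token_mx y) (i, j).
Proof.
rewrite /cost /pair_cost /= norm2_sqr; congr (_ + _).
by apply: eq_bigr => k _; rewrite !mxE.
Qed.

Lemma cost_ge0 (z : X * X) : 0 <= cost lambda z.
Proof. by rewrite addr_ge0 ?sqr_ge0// mulr_ge0 ?sqr_ge0// ltW. Qed.

Lemma cost_continuous : continuous (@cost R N d lambda S hS hN).
Proof.
have -> : (@cost R N d lambda S hS hN) = fun z =>
    \sum_k (subT_val z.1.2 k 0 - subT_val z.2.2 k 0) ^+ 2 +
    lambda * `|subT_val z.1.1 - subT_val z.2.1| ^+ 2.
  apply/funext => z; rewrite /cost norm2_sqr; congr (_ + _).
  by apply: eq_bigr => k _; rewrite !mxE.
have c1 := comp_cont (@fst_cont X X) (@Xpos_continuous R N d S hS hN).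
have c2 := comp_cont (@snd_cont X X) (@Xpos_continuous R N d S hS hN).
have c3 k := comp_cont (@fst_cont X X) (@Xcoord_continuous R N d S hS hN k).
have c4 k := comp_cont (@snd_cont X X) (@Xcoord_continuous R N d S hS hN k).
apply: rcontD.
  by apply: rcont_sum => k; apply: rcontX; exact: (rcontB (c3 k) (c4 k)).
apply: rcontM; first exact: rcont_cst.
by apply: rcontX; apply: rcont_norm; exact: (rcontB c1 c2).
Qed.

(** The transport polytope of two uniform measures: bistochastic matrices divided by N. *)
Definition plans : set ('I_N * 'I_N -> R) :=
  [set w | [/\ forall ij, 0 <= w ij, forall i, \sum_j w (i, j) = N%:R^-1 &
               forall j, \sum_i w (i, j) = N%:R^-1]].

Lemma sum_uniform : \sum_(i < N) (N%:R^-1 : R) = 1.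
Proof. by rewrite sumr_const card_ord -[LHS]mulr_natr mulVf// pnatr_eq0 -lt0n. Qed.

Lemma plans_sum w : plans w -> \sum_ij w ij = 1.
Proof.
case=> _ wr _; rewrite -sum_uniform (eq_bigr (fun i => \sum_j w (i, j))) => [|i _];
  last by rewrite wr.
by rewrite pair_bigA/=; apply: eq_bigr => -[].
Qed.

Definition transport (x y : 'M[R]_(d, N)) : R :=
  inf [set \sum_ij w ij * pair_cost x y ij | w in plans].

Lemma plans_nonempty : plans !=set0.
Proof.
exists (fun ij => N%:R^-1 * N%:R^-1); split => [ij|i|j].
- by rewrite mulr_ge0// invr_ge0.
- by rewrite -mulr_suml sum_uniform mul1r.
- by rewrite -mulr_suml sum_uniform mul1r.
Qed.

Lemma plan_cost_ge0 x y w : plans w -> 0 <= \sum_ij w ij * pair_cost x y ij.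
Proof.
by case=> w0 _ _; apply: sumr_ge0 => ij _; rewrite mulr_ge0// pair_cost_ge0.
Qed.

Definition token2 x y (ij : 'I_N * 'I_N) : X * X := (token hN x ij.1, token hN y ij.2).

Lemma measurable_token x i : measurable ([set token hN x i] : set (borel X)).
Proof. by apply: (@borel_closed X); exact: closed_set1X. Qed.

Lemma measurable_tokensC x : measurable (~` range (token hN x) : set (borel X)).
Proof.
apply: measurableC; rewrite -bigcup_imset1; apply: fin_bigcup_measurable => [|i _].
  exact: finite_finset.
exact: measurable_token.
Qed.

Lemma tokens_compl0 (mu : Prob R X) x : is_tokens mu x -> mu (~` range (token hN x)) = 0%E.
Proof.
move=> /(_ (~` range (token hN x)) (measurable_tokensC x)) ->.
rewrite big1// => i _; rewrite indicE memNset ?mulr0// => nr; apply: nr.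
by exists i.
Qed.

Lemma indic_token (x : 'I_N -> subT hS) i k :
  \1_[set token hN x i] (token hN x k) = (k == i)%:R :> R.
Proof.
rewrite indicE; case: eqP => [->|ki]; first by rewrite mem_set.
by rewrite memNset// => /token_inj.
Qed.

Lemma sum_fst_eq (F : 'I_N * 'I_N -> R) i :
  \sum_ij F ij * (ij.1 == i)%:R = \sum_j F (i, j).
Proof.
rewrite (eq_bigr (fun p => F (p.1, p.2) * (p.1 == i)%:R)) => [|[]//].
rewrite -(pair_bigA _ (fun k j => F (k, j) * (k == i)%:R))/= (bigD1 i)//= [X in _ + X]big1 ?addr0.
  by apply: eq_bigr => j _; rewrite eqxx mulr1.
by move=> k /negbTE ki; apply: big1 => j _; rewrite ki mulr0.
Qed.

Lemma sum_snd_eq (F : 'I_N * 'I_N -> R) j :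
  \sum_ij F ij * (ij.2 == j)%:R = \sum_i F (i, j).
Proof.
rewrite (eq_bigr (fun p => F (p.1, p.2) * (p.2 == j)%:R)) => [|[]//].
rewrite -(pair_bigA _ (fun i k => F (i, k) * (k == j)%:R))/=.
apply: eq_bigr => i _; rewrite (bigD1 j)//= eqxx mulr1 big1 ?addr0//.
by move=> k /negbTE kj; rewrite kj mulr0.
Qed.

Lemma sum_token1 (x : 'I_N -> subT hS) i :
  \sum_k N%:R^-1 * \1_[set token hN x i] (token hN x k) = N%:R^-1 :> R.
Proof.
rewrite (bigD1 i)//= indic_token eqxx mulr1 big1 ?addr0// => k /negbTE ki.
by rewrite indic_token ki mulr0.
Qed.

(** The marginals force [pi] onto the finite grid of token pairs. Its point masses then form a plan:
    evaluating the marginals on single tokens gives the row and column sums. *)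
Lemma coupling_plan mu nu x y (pi : Prob R (X * X)%type) :
  is_tokens mu x -> is_tokens nu y -> couplings mu nu pi ->
  exists2 w, plans w & atomic pi w (token2 x y).
Proof.
move=> mux nuy cpl.
have inj : injective (token2 x y).
  move=> [i j] [i' j'] E.
  have /= -> := token_inj (congr1 fst E).
  by have /= -> := token_inj (congr1 snd E).
have cl ij : closed [set token2 x y ij].
  have -> : [set token2 x y ij] = fst @^-1` [set token hN x ij.1] `&`
                                  snd @^-1` [set token hN y ij.2].
    by apply/seteqP; split => [_ ->//|[z z'] []/= -> ->].
  apply: closedI; apply: closed_comp; try exact: closed_set1X.
  - by move=> ? _; exact: fst_cont.
  - by move=> ? _; exact: snd_cont.
have mrange := measurable_tokensC.
have mfst (B : set (borel X)) : measurable B -> measurable (fst @^-1` B : set (borel (X * X)%type)).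
  move=> mB; rewrite -[X in measurable X]setTI.
  exact: (continuous_borel (@fst_cont X X)).
have msnd (B : set (borel X)) : measurable B -> measurable (snd @^-1` B : set (borel (X * X)%type)).
  move=> mB; rewrite -[X in measurable X]setTI.
  exact: (continuous_borel (@snd_cont X X)).
(* A pair off the grid has its first component off the tokens of [x] or its second off those of [y];
   the marginals make both cylinders null. *)
have pi0 : pi (~` range (token2 x y)) = 0%E.
  apply/eqP; rewrite eq_le measure_ge0 andbT.
  have E1 : pi (fst @^-1` (~` range (token hN x))) = 0%E.
    by rewrite (cpl _ (mrange x)).1 tokens_compl0.
  have E2 : pi (snd @^-1` (~` range (token hN y))) = 0%E.
    by rewrite (cpl _ (mrange y)).2 tokens_compl0.
  rewrite -[leRHS](adde0 0%E) -[X in (X + _)%E]E1 -[X in (_ + X)%E]E2.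
  apply: (le_trans _ (measureU2 _ (mfst _ (mrange x)) (msnd _ (mrange y)))).
  apply: le_measure; rewrite ?inE.
  - apply: measurableC; rewrite -bigcup_imset1; apply: fin_bigcup_measurable => [|i _].
      exact: finite_finset.
    by apply: (@borel_closed (X * X)%type); exact: cl.
  - by apply: measurableU; [exact: mfst|exact: msnd].
  - move=> [z z'] nr; apply: contrapT => /not_orP[/contrapT[i _ iz] /contrapT[j _ jz']].
    by apply: nr; exists (i, j) => //; rewrite /token2 iz jz'.
have api := concentrated_atomic inj cl pi0.
set w := (fun ij => _) in api.
exists w => //; split => [ij|i|j].
- by rewrite fine_ge0.
- have m := measurable_token x i.
  have [] := etrans (esym (api _ (mfst _ m))) (etrans (cpl _ m).1 (mux _ m)).
  rewrite sum_token1 -sum_fst_eq => <-; apply: eq_bigr => -[k l] _ /=.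
  by rewrite -(indic_token x) !indicE.
- have m := measurable_token y j.
  have [] := etrans (esym (api _ (msnd _ m))) (etrans (cpl _ m).2 (nuy _ m)).
  rewrite sum_token1 -sum_snd_eq => <-; apply: eq_bigr => -[k l] _ /=.
  by rewrite -(indic_token y) !indicE.
Qed.

Lemma plan_coupling mu nu x y w :
  is_tokens mu x -> is_tokens nu y -> plans w ->
  exists2 pi : Prob R (X * X)%type, couplings mu nu pi & atomic pi w (token2 x y).
Proof.
move=> mux nuy plw; have [w0 wr wc] := plw.
have [pi api] := atomic_exists (token2 x y) w0 (plans_sum plw).
exists pi => // B mB; split.
- rewrite api; last first.
    rewrite -[X in measurable X]setTI.
    exact: (continuous_borel (@fst_cont X X)).
  rewrite mux//; congr (_%:E).
  rewrite (eq_bigr (fun p => w (p.1, p.2) * \1_B (token hN x p.1))); last first.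
    by move=> [i j] _; rewrite !indicE.
  rewrite -(pair_bigA _ (fun i j => w (i, j) * \1_B (token hN x i)))/=.
  by apply: eq_bigr => i _; rewrite -mulr_suml wr.
- rewrite api; last first.
    rewrite -[X in measurable X]setTI.
    exact: (continuous_borel (@snd_cont X X)).
  rewrite nuy//; congr (_%:E).
  rewrite (eq_bigr (fun p => w (p.1, p.2) * \1_B (token hN y p.2))); last first.
    by move=> [i j] _; rewrite !indicE.
  rewrite -(pair_bigA _ (fun i j => w (i, j) * \1_B (token hN y j)))/= exchange_big/=.
  by apply: eq_bigr => j _; rewrite -mulr_suml wc.
Qed.

Lemma atomic_cost pi w x y : (forall ij, 0 <= w ij) -> atomic pi w (token2 x y) ->
  (\int[pi]_z (cost lambda z)%:E =
   (\sum_ij w ij * pair_cost (token_mx x) (token_mx y) ij)%:E)%E.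
Proof.
move=> w0 api; rewrite (atomic_integral w0 api).
- rewrite -sumEFin; apply: eq_bigr => -[i j] _.
  by rewrite cost_token EFinM.
- by apply/measurable_EFinP; apply: continuous_borelR; exact: cost_continuous.
- by move=> z; rewrite lee_fin cost_ge0.
Qed.

Lemma transport_has_lbound x y :
  has_lbound [set \sum_ij w ij * pair_cost x y ij | w in plans].
Proof. by exists 0 => _ [w plw <-]; exact: plan_cost_ge0. Qed.

Lemma transport_ge0 x y : 0 <= transport x y.
Proof.
apply: lb_le_inf; last by move=> _ [w plw <-]; exact: plan_cost_ge0.
by have [w plw] := plans_nonempty; eexists; exists w.
Qed.

(** Couplings and plans realise exactly the same set of costs, so the two infima agree. The infimum
    is nonnegative, hence squaring undoes the exponent 1/2 in [W2]. *)
Lemma W2_tokens (mu nu : Prob R X) x y : is_tokens mu x -> is_tokens nu y ->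
  (W2 lambda mu nu ^+ 2 = (transport (token_mx x) (token_mx y))%:E)%E.
Proof.
move=> mux nuy; rewrite /W2.
rewrite (_ : [set _ | _ in _] = EFin @`
    [set \sum_ij w ij * pair_cost (token_mx x) (token_mx y) ij | w in plans]).
  rewrite ereal_inf_EFin; last 2 first.
  - exact: transport_has_lbound.
  - by have [w plw] := plans_nonempty; eexists; exists w.
  rewrite -/(transport _ _) poweR_EFin -EFin_expe; congr (_%:E).
  by rewrite powR12_sqrt ?transport_ge0// sqr_sqrtr ?transport_ge0.
apply/seteqP; split.
  move=> _ [pi cpl <-]; have [w plw api] := coupling_plan mux nuy cpl.
  exists (\sum_ij w ij * pair_cost (token_mx x) (token_mx y) ij); first by exists w.
  by rewrite (atomic_cost _ api)//; case: plw.
move=> _ [_ [w plw <-] <-]; have [pi cpl api] := plan_coupling mux nuy plw.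
by exists pi => //; rewrite (atomic_cost _ api)//; case: plw.
Qed.

(** Every plan has total weight one, so a uniform error on pair costs becomes the same error on the
    total cost of that plan. The bound is thus uniform over plans and survives the infimum, which
    yields continuity of [transport]. *)
Lemma transport_le x y x' y' e : (forall ij, pair_cost x' y' ij <= pair_cost x y ij + e) ->
  transport x' y' <= transport x y + e.
Proof.
move=> h; rewrite -lerBlDr; apply: lb_le_inf.
  by have [w plw] := plans_nonempty; eexists; exists w.
move=> _ [w plw <-]; rewrite lerBlDr.
apply: (@le_trans _ _ (\sum_ij w ij * pair_cost x' y' ij)).
  by apply: ge_inf; [exact: transport_has_lbound|exists w].
rewrite -[X in _ + X]mul1r -(plans_sum plw) mulr_suml -big_split/=.
by apply: ler_sum => ij _; rewrite -mulrDr ler_wpM2l//; case: plw.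
Qed.

Lemma transport_continuous (T : topologicalType) (F G : T -> 'M[R]_(d, N)) :
  continuous F -> continuous G -> continuous (fun t => transport (F t) (G t)).
Proof.
move=> cF cG t; apply/cvgrPdist_le => e e0.
have c ij : continuous (fun t => pair_cost (F t) (G t) ij).
  apply: rcontD; last exact: rcont_cst.
  apply: rcont_sum => k; apply: rcontX.
  exact: (rcontB (comp_cont cF (@coord_continuous R d N k ij.1))
                 (comp_cont cG (@coord_continuous R d N k ij.2))).
near=> s.
have H ij : `|pair_cost (F t) (G t) ij - pair_cost (F s) (G s) ij| <= e.
  move: ij; near: s; apply: filter_forall => ij.
  by have /cvgrPdist_le := c ij t; exact.
have h1 : transport (F t) (G t) <= transport (F s) (G s) + e.
  by apply: transport_le => ij; have := H ij; rewrite ler_norml; lra.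
have h2 : transport (F s) (G s) <= transport (F t) (G t) + e.
  by apply: transport_le => ij; have := H ij; rewrite ler_norml; lra.
by rewrite ler_norml; lra.
Unshelve. all: by end_near. Qed.

End Transport.

(** * Continuity of matrix operations *)

Section MatrixContinuity.
Variables (R : realType) (T : topologicalType).

Lemma coord_cont m n (F : T -> 'M[R]_(m, n)) i j :
  continuous F -> continuous (fun t => F t i j).
Proof. by move=> cF; exact: (comp_cont cF (@coord_continuous R m n i j)). Qed.

Lemma mulmx_cont m n p (F : T -> 'M[R]_(m, n)) (G : T -> 'M[R]_(n, p)) :
  continuous F -> continuous G -> continuous (fun t => F t *m G t).
Proof.
move=> cF cG; apply: mx_continuous => i j; under eq_fun do rewrite mxE.
by apply: rcont_sum => k; apply: rcontM; exact: coord_cont.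
Qed.

Lemma addmx_cont m n (F G : T -> 'M[R]_(m, n)) :
  continuous F -> continuous G -> continuous (fun t => F t + G t).
Proof.
move=> cF cG; apply: mx_continuous => i j; under eq_fun do rewrite mxE.
by apply: rcontD; exact: coord_cont.
Qed.

Lemma scalemx_cont m n (f : T -> R) (F : T -> 'M[R]_(m, n)) :
  continuous f -> continuous F -> continuous (fun t => f t *: F t).
Proof.
move=> cf cF; apply: mx_continuous => i j; under eq_fun do rewrite mxE.
by apply: rcontM => //; exact: coord_cont.
Qed.

Lemma col_cont m n (F : T -> 'M[R]_(m, n)) j :
  continuous F -> continuous (fun t => col j (F t)).
Proof.
move=> cF; apply: mx_continuous => i k; under eq_fun do rewrite mxE.
exact: coord_cont.
Qed.

Lemma dotp_cont n (F G : T -> 'cV[R]_n) :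
  continuous F -> continuous G -> continuous (fun t => dotp (F t) (G t)).
Proof. by move=> cF cG; apply: rcont_sum => k; apply: rcontM; exact: coord_cont. Qed.

End MatrixContinuity.

Lemma coord_le_norm2 (R : realType) n (u : 'cV[R]_n) i : `|u i 0| <= norm2 u.
Proof.
rewrite -sqrtr_sqr ler_wsqrtr// /dotp (bigD1 i)//= -expr2 lerDl.
by apply: sumr_ge0 => j _; rewrite -expr2 sqr_ge0.
Qed.

(** The Lipschitz bound is Euclidean while the topology is entrywise. The two are linked by bounding
    an entry by [norm2], and by [norm2 (u - v)] being continuous in [v] and zero at [u]. *)
Lemma lipschitz1_continuous (R : realType) m n (g : 'cV[R]_m -> 'cV[R]_n) :
  lipschitz1 g -> continuous g.
Proof.
move=> lg; apply: mx_continuous => i j; rewrite ord1.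
suff cg (u : 'cV[R]_m) : (fun v => g v i 0) @ nbhs u --> g u i 0 by exact: cg.
have cn : continuous (fun v : 'cV[R]_m => norm2 (u - v)).
  apply: (@comp_cont _ _ _ (fun v : 'cV[R]_m => dotp (u - v) (u - v))); last exact: sqrt_continuous.
  have c : continuous (fun v : 'cV[R]_m => u - v).
    apply: mx_continuous => k l; under eq_fun do rewrite !mxE.
    by apply: rcontB; [exact: rcont_cst|exact: coord_continuous].
  exact: dotp_cont.
have n0 : norm2 (u - u) = 0.
  by rewrite subrr /norm2 /dotp big1 ?sqrtr0// => k _; rewrite mxE mul0r.
apply/cvgrPdist_le => e e0; have /cvgrPdist_le/(_ e e0) := cn u; rewrite n0.
apply: filterS => v; rewrite sub0r normrN ger0_norm ?sqrtr_ge0// => uv.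
have := coord_le_norm2 (g u - g v) i; rewrite !mxE => /le_trans; apply.
exact: (le_trans (lg u v)).
Qed.

(** * A layer as a map of token matrices *)

Section Layer.
Variables (R : realType) (N d d1 d2 : nat) (beta : R).
Variables (sigma : 'cV[R]_d1 -> 'cV[R]_d1) (S : set 'cV[R]_d) (hS : S !=set0).
Hypotheses (hN : (0 < N)%N) (hsigma : lipschitz1 sigma).
Local Notation X := (XX hS hN).
Local Notation act := (action R d d1 d2).

Definition attention_weight (U : act) (x z : 'cV[R]_d) : R :=
  expR (beta * dotp (U.1.1.2 *m x) (U.1.2 *m z)).

(** The layer for a measure uniform on the columns of [M]. The factor 1/N is kept in numerator and
    denominator so that both sums match integrals against an atomic measure term by term. *)
Definition token_layer (U : act) (x : 'cV[R]_d) (M : 'M[R]_(d, N)) : 'cV[R]_d :=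
  U.1.1.1.1.1 *m sigma (U.1.1.1.1.2 *m x + U.1.1.1.2) +
  (\sum_j N%:R^-1 * attention_weight U x (col j M))^-1 *:
   \col_k \sum_j N%:R^-1 * (attention_weight U x (col j M) * (U.2 *m col j M) k 0).

Definition token_step (U : act) (M : 'M[R]_(d, N)) : 'M[R]_(d, N) :=
  \matrix_(k, i) token_layer U (col i M) M k 0.

Section Continuity.
Variable T : topologicalType.

Lemma attention_weight_cont (U : T -> act) (x z : T -> 'cV[R]_d) :
  continuous U -> continuous x -> continuous z ->
  continuous (fun t => attention_weight (U t) (x t) (z t)).
Proof.
move=> cU cx cz; apply: rcont_expR; apply: rcontM; first exact: rcont_cst.
apply: dotp_cont; apply: mulmx_cont => //.
- exact: (comp_cont (comp_cont (comp_cont cU (@fst_cont _ _)) (@fst_cont _ _)) (@snd_cont _ _)).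
- exact: (comp_cont (comp_cont cU (@fst_cont _ _)) (@snd_cont _ _)).
Qed.

Lemma token_layer_cont (U : T -> act) x M :
  continuous U -> continuous x -> continuous M ->
  continuous (fun t => token_layer (U t) (x t) (M t)).
Proof.
move=> cU cx cM.
have c1 := comp_cont cU (@fst_cont _ _).
have c2 := comp_cont c1 (@fst_cont _ _).
have c3 := comp_cont c2 (@fst_cont _ _).
have c4 := comp_cont c3 (@fst_cont _ _).
have cV := comp_cont cU (@snd_cont _ _).
have cb := comp_cont c3 (@snd_cont _ _).
have cA := comp_cont c4 (@snd_cont _ _).
have cW := comp_cont c4 (@fst_cont _ _).
have cw j : continuous (fun t => attention_weight (U t) (x t) (col j (M t))).
  by apply: attention_weight_cont => //; exact: col_cont.
apply: addmx_cont.
  apply: (mulmx_cont cW).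
  exact: (comp_cont (addmx_cont (mulmx_cont cA cx) cb) (lipschitz1_continuous hsigma)).
apply: scalemx_cont.
  apply: rcontV.
    (* The denominator is 1/N times a sum of exponentials; the first index, which exists because N
       is positive, contributes a strictly positive term. *)
    move=> t; rewrite -mulr_sumr mulf_neq0// ?invr_eq0 ?pnatr_eq0 -?lt0n//.
    rewrite gt_eqF// (bigD1 (Ordinal hN))//= ltr_pwDl ?expR_gt0//.
    by apply: sumr_ge0 => j _; exact: expR_ge0.
  by apply: rcont_sum => j; apply: rcontM; [exact: rcont_cst|exact: cw].
apply: mx_continuous => k l; under eq_fun do rewrite mxE.
apply: rcont_sum => j; apply: rcontM; first exact: rcont_cst.
apply: (rcontM (cw j)); apply: coord_cont.
by apply: (mulmx_cont cV); exact: col_cont.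
Qed.

Lemma token_step_cont (U : T -> act) M :
  continuous U -> continuous M -> continuous (fun t => token_step (U t) (M t)).
Proof.
move=> cU cM; apply: mx_continuous => k i; under eq_fun do rewrite mxE.
by apply: coord_cont; apply: token_layer_cont => //; exact: col_cont.
Qed.

End Continuity.

Lemma col_token_mx (x : 'I_N -> subT hS) i : col i (token_mx x) = subT_val (x i).
Proof. by apply/colP => k; rewrite !mxE. Qed.

Lemma layer_tokens (mu : Prob R X) x (z : subT hS) (U : act) : is_tokens mu x ->
  layer beta sigma z U mu = token_layer U (subT_val z) (token_mx x).
Proof.
move=> mux; have muSx : atomic (push (@snd _ _) mu : Prob R (subT hS)) (fun=> N%:R^-1) x.
  exact: (atomic_push mux (continuous_borel (@snd_cont _ _))).
have w0 (i : 'I_N) : 0 <= N%:R^-1 :> R by rewrite invr_ge0.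
case: U => [[[[[W A] b] Q] K] V]; rewrite /layer /token_layer/=.
have cw : continuous (fun y : subT hS => expR (beta * dotp (Q *m subT_val z) (K *m subT_val y))).
  apply: (@attention_weight_cont _ (fun=> (W, A, b, Q, K, V)) (fun=> subT_val z)).
  - exact: cst_continuous.
  - exact: cst_continuous.
  - exact: subT_val_continuous.
congr (_ + _ *: _).
  rewrite (atomic_Rintegral w0 muSx)//; congr (_^-1).
  by apply: eq_bigr => j _; rewrite col_token_mx.
apply/colP => k; rewrite !mxE (atomic_Rintegral w0 muSx).
  by apply: eq_bigr => j _; rewrite col_token_mx.
apply: rcontM => //; apply: coord_cont; apply: mulmx_cont; last exact: subT_val_continuous.
exact: cst_continuous.
Qed.

Variables (UU : set act) (hf : layer_stable beta sigma hS hN UU).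

(** A layer leaves positions untouched, so the image again has one token at each position. For a
    token measure the layer is continuous in the point, so [push] takes its measurable branch and
    moves the atoms. *)
Lemma Phi_tokens (mu : Prob R X) x (U : UU) : is_tokens mu x ->
  exists2 x', is_tokens (Phi hf mu U) x' &
    token_mx x' = token_step (set_val U) (token_mx x).
Proof.
move=> mux; exists (fun i => subT_sub hS (hf (x i) mu (set_valP U))); last first.
  apply/matrixP => k i; rewrite mxE [RHS]mxE col_token_mx.
  exact: (congr1 (fun v : 'cV[R]_d => v k 0) (layer_tokens (x i) (set_val U) mux)).
apply: (atomic_push mux); apply: continuous_borel.
apply: pair_cont; first exact: fst_cont.
apply: subT_sub_continuous.
under eq_fun do rewrite (layer_tokens _ _ mux).
apply: token_layer_cont.
- exact: cst_continuous.
- exact: Xtok_continuous.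
- exact: cst_continuous.
Qed.

Lemma foldl_Phi_tokens (s : seq UU) (mu : Prob R X) x : is_tokens mu x ->
  exists2 x', is_tokens (foldl (Phi hf) mu s) x' &
    token_mx x' = foldl (fun M U => token_step (set_val U) M) (token_mx x) s.
Proof.
elim: s mu x => [|U s IH] mu x mux /=; first by exists x.
have [x' mux' <-] := Phi_tokens U mux.
exact: IH.
Qed.

(** Separating the family [u] from the fixed list of indices [s] allows continuity in [u] to be
    expressed coordinatewise. *)
Definition token_iter (I : Type) (u : I -> act) (s : seq I) (M : 'M[R]_(d, N)) :=
  foldl (fun M i => token_step (u i) M) M s.

Lemma token_iter_cont (T : topologicalType) (I : Type) (u : T -> I -> act) s M :
  (forall i, continuous (u ^~ i)) -> continuous M ->
  continuous (fun t => token_iter (u t) s (M t)).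
Proof.
move=> cu; elim: s M => [//|i s IH] M cM.
by apply: IH; exact: token_step_cont.
Qed.

End Layer.

(** * Bounded continuous test functions *)

Section BoundedContinuous.
Variables (R : realType) (T : ptopologicalType).
Implicit Types f g : T -> R.

Definition bcont f := continuous f /\ exists M, forall x, `|f x| <= M.

Lemma bcont_bounded f : bcont f -> bounded_fun f.
Proof.
move=> [_ [M fM]]; exists M; split; first exact: num_real.
by move=> e Me x _ /=; apply: (le_trans (fM x)); exact: ltW.
Qed.

Lemma bcontM f g : bcont f -> bcont g -> bcont (fun x => f x * g x).
Proof.
move=> [cf [A fA]] [cg [B gB]]; split; first exact: rcontM.
by exists (A * B) => x; rewrite normrM ler_pM.
Qed.

Lemma bcont_cst c : bcont (fun=> c).
Proof. by split; [exact: rcont_cst|exists `|c|]. Qed.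

Lemma bcontB f g : bcont f -> bcont g -> bcont (fun x => f x - g x).
Proof.
move=> [cf [A fA]] [cg [B gB]]; split; first exact: rcontB.
by exists (A + B) => x; rewrite (le_trans (ler_normB _ _))// lerD.
Qed.

Lemma bcont_integrable (mu : Prob R T) f : bcont f -> mu.-integrable setT (EFin \o f).
Proof.
move=> bf; apply: measurable_bounded_integrable => //.
- by rewrite ltey_eq fin_num_measure.
- exact: continuous_borelR bf.1.
- exact: bcont_bounded.
Qed.

(** The topology on [Prob R T] is initial for [bc_integrals]; integration of [f] is that map
    followed by the projection at the index [F]. *)
Lemma Rintegral_continuous f : bcont f -> continuous (fun mu : Prob R T => \int[mu]_x f x).
Proof.
move=> bf; pose F : bcfun R T := exist _ f (conj bf.1 (bcont_bounded bf)).
exact: (comp_cont (@initial_continuous _ _ (@bc_integrals R T))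
  (@proj_continuous _ (fun _ : bcfun R T => R : topologicalType) F)).
Qed.

Lemma bcont_fin_num (mu : Prob R T) f : bcont f -> (\int[mu]_x (f x)%:E)%E \is a fin_num.
Proof. by move=> bf; apply: integrable_fin_num => //; exact: bcont_integrable. Qed.

Lemma Rintegral_eq0_null (mu : Prob R T) f : bcont f -> (forall x, 0 <= f x) ->
  \int[mu]_x f x = 0 -> mu [set x | f x != 0] = 0%E.
Proof.
move=> bf f0 If0.
have mf : measurable_fun setT (EFin \o f : borel T -> \bar R).
  by apply/measurable_EFinP; exact: continuous_borelR bf.1.
have : (\int[mu]_x `|(EFin \o f) x| = 0)%E.
  under eq_integral => x _ do rewrite /= ger0_norm//.
  by rewrite -(fineK (bcont_fin_num mu bf)) -/(Rintegral _ _ _) If0.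
move=> /(ae_eq_integral_abs mu measurableT mf) [A [mA A0 sA]].
apply/eqP; rewrite eq_le measure_ge0 andbT -A0; apply: le_measure; rewrite ?inE//.
  apply: borel_open; rewrite (_ : mkset _ = f @^-1` [set r | r != 0])//.
  by move: bf.1 => /continuousP; apply; exact: open_neq.
by move=> x /= fx; apply: sA => /= /(_ I) [] /eqP; exact/negP.
Qed.

Lemma null_bigcup_fin (I : finType) (mu : Prob R T) (F : I -> set (borel T)) :
  (forall i, measurable (F i)) -> (forall i, mu (F i) = 0%E) ->
  mu (\bigcup_i F i) = 0%E.
Proof.
move=> mF F0; rewrite (_ : [set: I] = [set` index_enum I]); last first.
  by apply/seteqP; split => // i _; rewrite /= mem_index_enum.
rewrite bigcup_seq; elim: (index_enum I) => [|i s IH].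
  by rewrite big_nil measure0.
rewrite big_cons; apply/eqP; rewrite eq_le measure_ge0 andbT.
rewrite -[leRHS](adde0 0%E) -[X in (X + _)%E](F0 i) -[X in (_ + X)%E]IH.
by apply: measureU2 => //; exact: bigsetU_measurable.
Qed.

End BoundedContinuous.

(** * Barycenters, and the defect that detects token measures *)

Section Barycenter.
Variables (R : realType) (N d : nat) (S : set 'cV[R]_d) (hS : S !=set0).
Hypotheses (hN : (0 < N)%N) (hScompact : compact S).
Local Notation X := (XX hS hN).

(** A tent of height 1 and half-width 1/N. As positions are spaced by 1/N, it is the indicator of
    position [i] on [X], written so that continuity is visible. *)
Definition bump (i : 'I_N) (z : X) : R :=
  Num.max 0 (1 - N%:R * `|subT_val z.1 - position R i|).

Lemma bump_position i j (z : X) : subT_val z.1 = position R j -> bump i z = (j == i)%:R.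
Proof.
rewrite /bump => ->; have N0 : N%:R != 0 :> R by rewrite pnatr_eq0 -lt0n.
case: eqP => [->|ji].
  by rewrite subrr normr0 mulr0 subr0; apply/max_idPr.
apply/max_idPl; rewrite subr_le0 -[X in X * _]ger0_norm// -normrM mulrBr /position.
rewrite !(mulrC N%:R) !divfK//.
(* N times the gap between two distinct positions is a nonzero integer, hence at least 1 in absolute
   value, and the tent vanishes. *)
have : j.+1%:R - i.+1%:R = (j.+1%:Z - i.+1%:Z)%:~R :> R by rewrite rmorphB.
move=> ->; rewrite -intr_norm ler1z -gtz0_ge1 normr_gt0 subr_eq0.
by apply: contra_not_neq ji => -[] /val_inj.
Qed.

Lemma bumpE i (z : X) : exists j, subT_val z.1 = position R j /\ bump i z = (j == i)%:R.
Proof.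
have [j _ jz] : PE N (subT_val z.1) by exact: set_valP.
by exists j; split => //; exact: bump_position.
Qed.

Lemma bump_token (x : 'I_N -> subT hS) i j : bump i (token hN x j) = (j == i)%:R.
Proof. exact: bump_position. Qed.

Lemma bcont_bump i : bcont (bump i).
Proof.
split; last first.
  exists 1 => z; have [j [_ ->]] := bumpE i z.
  by case: eqP; rewrite ?normr1 ?normr0.
apply: rcont_max; first exact: rcont_cst.
apply: rcontB; first exact: rcont_cst.
apply: rcontM; first exact: rcont_cst.
apply: rcont_norm; apply: rcontB; last exact: rcont_cst.
exact: Xpos_continuous.
Qed.

Lemma bcont_coord k : bcont (fun z : X => subT_val z.2 k 0).
Proof.
split; first exact: Xcoord_continuous.
have : compact ((fun s : 'cV[R]_d => s k 0) @` S).
  apply: continuous_compact => //; apply: continuous_subspaceT.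
  exact: coord_continuous.
move=> /compact_bounded [M [_ MS]]; exists (M + 1) => z.
by apply: (MS (M + 1)); rewrite ?ltrDl//; exists (subT_val z.2) => //; exact: set_valP.
Qed.

Definition mass (mu : Prob R X) i : R := \int[mu]_z bump i z.
Definition moment1 (mu : Prob R X) i k : R := \int[mu]_z (bump i z * subT_val z.2 k 0).
Definition moment2 (mu : Prob R X) i k : R :=
  \int[mu]_z (bump i z * (subT_val z.2 k 0 * subT_val z.2 k 0)).

(** When position [i] has mass 1/N, column [i] is the conditional mean of the token at that
    position. *)
Definition bary (mu : Prob R X) : 'M[R]_(d, N) := \matrix_(k, i) (N%:R * moment1 mu i k).

(** If position [i] has mass 1/N, then [moment2 mu i k - N%:R * moment1 mu i k ^+ 2] is the integral
    over position [i] of the squared deviation of coordinate [k] from its conditional mean. Squaring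
    keeps each term nonnegative also for other masses. *)
Definition defect (mu : Prob R X) : R := \sum_i (mass mu i - N%:R^-1) ^+ 2 +
  \sum_i \sum_k (moment2 mu i k - N%:R * moment1 mu i k ^+ 2) ^+ 2.

Lemma bcont_moment1 i k : bcont (fun z : X => bump i z * subT_val z.2 k 0).
Proof. exact: bcontM (bcont_bump i) (bcont_coord k). Qed.

Lemma bcont_moment2 i k :
  bcont (fun z : X => bump i z * (subT_val z.2 k 0 * subT_val z.2 k 0)).
Proof. exact: bcontM (bcont_bump i) (bcontM (bcont_coord k) (bcont_coord k)). Qed.

Lemma moment1_continuous i k : continuous (fun mu => moment1 mu i k).
Proof. exact: Rintegral_continuous (bcont_moment1 i k). Qed.

Lemma bary_continuous : continuous bary.
Proof.
apply: mx_continuous => k i; under eq_fun do rewrite mxE.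
by apply: rcontM; [exact: rcont_cst|exact: moment1_continuous].
Qed.

Lemma defect_continuous : continuous defect.
Proof.
apply: rcontD; apply: rcont_sum => i.
  apply: rcontX; apply: rcontB; last exact: rcont_cst.
  exact: Rintegral_continuous (bcont_bump i).
apply: rcont_sum => k; apply: rcontX; apply: rcontB.
  exact: Rintegral_continuous (bcont_moment2 i k).
apply: rcontM; first exact: rcont_cst.
by apply: rcontX; exact: moment1_continuous.
Qed.

Lemma defect_ge0 mu : 0 <= defect mu.
Proof.
by apply: addr_ge0; repeat (apply: sumr_ge0 => ? _); exact: sqr_ge0.
Qed.

Lemma Rintegral_bump mu x i (g : X -> R) : is_tokens mu x ->
  continuous g -> \int[mu]_z (bump i z * g z) = N%:R^-1 * g (token hN x i).
Proof.
move=> mux cg; rewrite (atomic_Rintegral _ mux); last 2 first.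
- by move=> j; rewrite invr_ge0.
- by apply: rcontM => //; exact: (bcont_bump i).1.
rewrite (bigD1 i)//= bump_token eqxx mul1r big1 ?addr0// => j /negbTE ji.
by rewrite bump_token ji mul0r mulr0.
Qed.

Lemma bary_tokens mu x : is_tokens mu x -> bary mu = token_mx x.
Proof.
move=> mux; apply/matrixP => k i; rewrite !mxE /moment1 (Rintegral_bump i mux).
  by rewrite mulVKf// pnatr_eq0 -lt0n.
exact: Xcoord_continuous.
Qed.

Lemma mass_tokens mu x i : is_tokens mu x -> mass mu i = N%:R^-1.
Proof.
move=> mux; rewrite /mass -[RHS]mulr1 -(Rintegral_bump i mux (g := fun=> 1)).
  by apply: eq_Rintegral => z _; rewrite mulr1.
exact: rcont_cst.
Qed.

Lemma defect_tokens mu x : is_tokens mu x -> defect mu = 0.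
Proof.
move=> mux; have N0 : N%:R != 0 :> R by rewrite pnatr_eq0 -lt0n.
rewrite /defect !big1 ?addr0// => i _.
  apply: big1 => k _; rewrite /moment1 /moment2 !(Rintegral_bump i mux).
  - by apply/eqP; rewrite sqrf_eq0; apply/eqP; field.
  - exact: Xcoord_continuous.
  - by apply: rcontM; exact: Xcoord_continuous.
by rewrite (mass_tokens i mux) subrr expr0n.
Qed.

(** Zero defect gives every position mass 1/N and zero variance. Outside a finite union [A] of null
    sets, all points at position [i] therefore carry the mean [r i] as token, so [mu] is
    concentrated on N points. *)
Lemma defect_eq0 mu : defect mu = 0 -> exists x, is_tokens mu x.
Proof.
have N0 : N%:R != 0 :> R by rewrite pnatr_eq0 -lt0n.
move=> /eqP; rewrite paddr_eq0; last 2 first.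
- by apply: sumr_ge0 => i _; exact: sqr_ge0.
- by apply: sumr_ge0 => i _; apply: sumr_ge0 => k _; exact: sqr_ge0.
rewrite !psumr_eq0//; last 2 first.
- by move=> i _; apply: sumr_ge0 => k _; exact: sqr_ge0.
- by move=> i _; exact: sqr_ge0.
move=> /andP[/allP h1 /allP h2].
have m1 i : mass mu i = N%:R^-1.
  have := h1 i; rewrite mem_index_enum => /(_ isT); rewrite sqrf_eq0 subr_eq0.
  by move=> /eqP.
have m2 i k : moment2 mu i k = N%:R * moment1 mu i k ^+ 2.
  have := h2 i; rewrite mem_index_enum => /(_ isT) /=.
  rewrite psumr_eq0; last by move=> ? _; exact: sqr_ge0.
  move=> /allP/(_ k); rewrite mem_index_enum => /(_ isT) /=.
  by rewrite sqrf_eq0 subr_eq0 => /eqP.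
have {h1 h2} _ := I.
pose r i k := N%:R * moment1 mu i k.
pose q i k (z : X) := bump i z * ((subT_val z.2 k 0 - r i k) * (subT_val z.2 k 0 - r i k)).
have bq i k : bcont (q i k).
  have b := bcontB (bcont_coord k) (@bcont_cst R X (r i k)).
  exact: bcontM (bcont_bump i) (bcontM b b).
have bump_ge0 i z : 0 <= bump i z by have [j [_ ->]] := bumpE i z.
have q0 i k : mu [set z | q i k z != 0] = 0%E.
  apply: Rintegral_eq0_null => //.
    by move=> z; rewrite mulr_ge0// -expr2 sqr_ge0.
  (* Expanding the square writes the integral of [q i k] as the second moment minus 2r times the
     first plus r squared times the mass; [m1], [m2] and the choice of r as the mean make it
     vanish. *)
  have -> : q i k = fun z => (bump i z * (subT_val z.2 k 0 * subT_val z.2 k 0)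
      - (2 * r i k) * (bump i z * subT_val z.2 k 0)) - (- (r i k ^+ 2)) * bump i z.
    by apply/funext => z; rewrite /q; ring.
  have B1 := bcont_moment1 i k; have B2 := bcont_moment2 i k.
  have B3 := bcontM (@bcont_cst R X (2 * r i k)) B1.
  have B4 := bcontM (@bcont_cst R X (- r i k ^+ 2)) (bcont_bump i).
  rewrite RintegralB//; last 2 first.
  - exact: (bcont_integrable mu (bcontB B2 B3)).
  - exact: (bcont_integrable mu B4).
  rewrite RintegralB//; last 2 first.
  - exact: (bcont_integrable mu B2).
  - exact: (bcont_integrable mu B3).
  rewrite RintegralZl//; last exact: (bcont_integrable mu B1).
  rewrite RintegralZl//; last exact: (bcont_integrable mu (bcont_bump i)).
  rewrite -/(moment2 mu i k) -/(moment1 mu i k) -/(mass mu i) m1 m2 /r.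
  by field.
pose A := \bigcup_(ik : 'I_N * 'I_d) [set z | q ik.1 ik.2 z != 0].
have mq i k : measurable ([set z | q i k z != 0] : set (borel X)).
  apply: (@borel_open X); rewrite (_ : mkset _ = q i k @^-1` [set r | r != 0])//.
  by move: (bq i k).1 => /continuousP; apply; exact: open_neq.
have mA : measurable (A : set (borel X)).
  by apply: fin_bigcup_measurable => [|ik _]; [exact: finite_finset|exact: mq].
have A0 : mu A = 0%E.
  by apply: null_bigcup_fin => ik; [exact: mq|exact: q0].
(* Position [i] has positive mass, so it cannot be contained in the null set [A]. The point found
   here shows that the mean [r i] is an actual token, in particular an element of [S]. *)
have exz (i : 'I_N) : exists z : X, subT_val z.1 = position R i /\ ~ A z.
  apply: contrapT => nz.
  have bA (z : X) : bump i z <= \1_A z.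
    have [j [zj ->]] := bumpE i z; case: eqP => // ji.
    rewrite indicE mem_set//; apply: contrapT => nA; apply: nz.
    by exists z; rewrite zj ji.
  have : (\int[mu]_z (bump i z)%:E <= 0)%E.
    rewrite -A0 -[X in mu X]setIT -integral_indic//.
    apply: ge0_le_integral => //.
    - by move=> z _; rewrite lee_fin.
    - by apply/measurable_EFinP; exact: continuous_borelR (bcont_bump i).1.
    - by apply/measurable_EFinP; exact: measurable_indic.
    - by move=> z _; rewrite lee_fin.
  move=> /fine_le; rewrite (bcont_fin_num mu (bcont_bump i)) => /(_ isT isT).
  rewrite -/(Rintegral _ _ _) -/(mass mu i) m1 leNgt invr_gt0 ltr0n.
  by rewrite hN.
pose z (i : 'I_N) := projT1 (cid (exz i)); pose x (i : 'I_N) := (z i).2.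
have zP (i : 'I_N) : subT_val (z i).1 = position R i /\ ~ A (z i) := projT2 (cid (exz i)).
have nAP (i : 'I_N) (y : X) : subT_val y.1 = position R i -> ~ A y ->
    subT_val y.2 = \col_k r i k.
  move=> yi nA; apply/colP => k; rewrite mxE; apply/eqP; rewrite -subr_eq0.
  apply: contrapT => /negP h; apply: nA; exists (i, k) => //=.
  by rewrite /q (bump_position _ yi) eqxx mul1r mulf_neq0.
have tokA (y : X) : ~ A y -> range (token hN x) y.
  move=> nA; have [i [yi _]] := bumpE (Ordinal hN) y; exists i => //.
  case: y yi nA => p y /= yi nA; congr (_, _).
    by apply: subT_val_inj; rewrite /= yi.
  apply: subT_val_inj; rewrite (nAP i (p, y))// /x.
  by have [zi nz] := zP i; rewrite (nAP i (z i)).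
have r0 : mu (~` range (token hN x)) = 0%E.
  apply/eqP; rewrite eq_le measure_ge0 andbT -A0.
  apply: le_measure; rewrite ?inE//; first exact: measurable_tokensC.
  by move=> y nt; apply: contrapT => nA; exact/nt/tokA.
have at1 := concentrated_atomic (@token_inj _ _ _ _ hS hN x)
  (fun i => @closed_set1X _ _ _ _ hS hN _) r0.
(* Only the weights remain: integrating [bump i] isolates the mass of token [i], which [m1] says is
   1/N. *)
exists x => B mB; rewrite at1//; congr (_%:E); apply: eq_bigr => i _; congr (_ * _).
rewrite -(m1 i) /mass (atomic_Rintegral _ at1).
- rewrite (bigD1 i)//= bump_token eqxx mulr1 big1 ?addr0// => j /negbTE ji.
  by rewrite bump_token ji mulr0.
- by move=> j; rewrite fine_ge0.
- exact: (bcont_bump i).1.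
Qed.

End Barycenter.

(** * Integrals modulo null sets *)

Section NullSets.
Context d (T : measurableType d) (R : realType) (mu : {measure set T -> \bar R}).
Local Open Scope ereal_scope.
Import HBNNSimple.

(** The integral of an arbitrary nonnegative function is a supremum over the simple functions below
    it, and enlarging the function enlarges this family. *)
Lemma nonneg_integral_mono (f g : T -> \bar R) : (forall x, 0 <= f x) ->
  (forall x, f x <= g x) -> \int[mu]_x f x <= \int[mu]_x g x.
Proof.
move=> f0 fg; rewrite !ge0_integralTE//; last by move=> x; exact: le_trans (fg x).
by apply: ereal_sup_le => _ [h hf <-]; exists h => // x; exact: le_trans (fg x).
Qed.

(* [f] is not assumed to be measurable. *)
Lemma integral_eq_off_null (A : set T) (f g : T -> \bar R) :
  measurable A -> mu (~` A) = 0 -> (forall x, 0 <= f x) -> (forall x, 0 <= g x) ->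
  measurable_fun setT g -> (forall x, A x -> f x = g x) ->
  \int[mu]_x f x = \int[mu]_x g x.
Proof.
move=> mA muA f0 g0 mg fg.
have mAC : measurable (~` A) by exact: measurableC.
have red (h : T -> \bar R) : measurable_fun setT h -> (forall x, 0 <= h x) ->
    \int[mu]_x h x = \int[mu]_(x in A) h x.
  by move=> mh h0; rewrite (ge0_negligible_integral mAC _ mh) ?setTD ?setCK.
apply/eqP; rewrite eq_le; apply/andP; split.
  (* The integral of [f] is approached by simple [h] below [f]. The integral of [h] is already that
     over [A], where [h] is below [g]. *)
  rewrite ge0_integralTE//; apply: ge_ereal_sup => _ [h hf <-].
  have mh : measurable_fun setT (EFin \o h) by exact/measurable_EFinP.
  rewrite (_ : sintegral mu h = \int[mu]_x (h x)%:E); last by rewrite integral_nnsfun// patch_setT.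
  rewrite red//; last by move=> x; rewrite lee_fin.
  rewrite [leRHS]red//.
  apply: ge0_le_integral => //.
  - by move=> x _; rewrite lee_fin.
  - exact: measurable_funTS.
  - exact: measurable_funTS.
  - by move=> x Ax; rewrite -fg.
(* Conversely, the integral of [g] is that of [g] cut to zero off [A], and this function lies below
   [f] everywhere. *)
rewrite [leLHS]red// integral_mkcond; apply: nonneg_integral_mono.
  by move=> x; apply: erestrict_ge0.
move=> x; rewrite patchE; case: ifPn => [/set_mem Ax|_]; last exact: f0.
by rewrite fg.
Qed.

End NullSets.

Lemma Rintegral_bound_ae (R : realType) (T : ptopologicalType) (mu : Prob R T)
    (A : set (borel T)) f e :
  measurable A -> mu (~` A) = 0%E -> bcont f -> 0 <= e ->
  (forall x, A x -> `|f x| <= e) -> `|\int[mu]_x f x| <= e.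
Proof.
move=> mA A0 bf e0 fe.
apply: (le_trans (le_normr_Rintegral measurableT (bcont_integrable mu bf))).
have bn : bcont (fun x => `|f x|).
  split; first exact: rcont_norm bf.1.
  by have [M fM] := bf.2; exists M => x; rewrite normr_id.
rewrite -lee_fin fineK; last exact: bcont_fin_num.
have := @integral_le_bound _ (borel T) R mu setT (EFin \o f) e%:E measurableT.
rewrite [X in (_ * X)%E](_ : _ = 1%E) ?mule1; last exact: (@probability_setT _ (borel T) R mu).
apply.
- by apply/measurable_EFinP; exact: continuous_borelR bf.1.
- by rewrite lee_fin.
- exists (~` A); split => //; first exact: measurableC.
  by move=> x /= h Ax; apply: h => _; rewrite lee_fin fe.
Qed.

Lemma empirical_atomic (R : realType) (T : ptopologicalType) K (hK : (0 < K)%N) (x : 'I_K -> T) :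
  atomic (empirical R hK x) (fun=> K%:R^-1) x.
Proof.
move=> B mB; rewrite -mulr_sumr EFinM.
have -> : (\sum_i \1_B (x i))%:E = (\sum_(k < K) \d_(x k : borel T) B)%E :> \bar R.
  by rewrite -sumEFin.
by [].
Qed.

Lemma dist_le_third (R : realType) (a a' b b' e : R) : `|a' - a| <= e / 3 ->
  `|b' - b| <= e / 3 -> `|b - a| <= e / 3 -> `|a' - b'| <= e.
Proof. by rewrite !ler_norml; lra. Qed.

(** Write a' - a as (a' - b') + (b' - b) + (b - a): the middle term is at most 0 and the outer ones
    at most e/2. In the application a and a' are values for the limit, b and b' for the
    approximation, and primes mark the approximate minimiser. *)
Lemma min_dist_le (R : realType) (a a' b b' e : R) : a <= a' -> b' <= b ->
  `|b' - a'| <= e / 2 -> `|b - a| <= e / 2 -> `|a - a'| <= e.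
Proof. by rewrite !ler_norml; lra. Qed.

(** * The value as the mean of a bounded continuous cost *)

Section Value.
Variables (R : realType) (N d d1 d2 T : nat) (beta lambda : R).
Variables (sigma : 'cV[R]_d1 -> 'cV[R]_d1) (S : set 'cV[R]_d) (hS : S !=set0).
Hypotheses (hN : (0 < N)%N) (hsigma : lipschitz1 sigma) (hlambda : 0 < lambda).
Hypothesis (hScompact : compact S).
Local Notation X := (XX hS hN).
Local Notation act := (action R d d1 d2).
Local Notation Z := (Prob R X * Prob R X)%type.
Variables (UU : set act) (hf : layer_stable beta sigma hS hN UU).
Hypothesis hUcompact : compact UU.
Local Notation controls := {ptws 'I_T -> act}.

Definition token_set : set 'M[R]_(d, N) := range (@token_mx R N d S hS).

(** The image of a power of [S], compact by Tychonoff, under the continuous stacking of N vectors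
    into a matrix. *)
Lemma token_set_compact : compact token_set.
Proof.
have -> : token_set = (fun f : {ptws 'I_N -> 'cV[R]_d} => \matrix_(k, i) f i k 0) @`
    [set f : {ptws 'I_N -> 'cV[R]_d} | forall i, S (f i)].
  apply/seteqP; split.
    move=> _ [x _ <-]; exists (fun i => subT_val (x i)) => // i; exact: set_valP.
  move=> _ [f Sf <-]; exists (fun i => subT_sub hS (Sf i)) => //.
apply: continuous_compact; last first.
  by apply: (@tychonoff _ (fun=> 'cV[R]_d : topologicalType) (fun=> S)) => _.
apply: continuous_subspaceT; apply: mx_continuous => k i.
suff -> : (fun f : {ptws 'I_N -> 'cV[R]_d} => (\matrix_(k, i) f i k 0) k i) = fun f => f i k 0.
  by apply: coord_cont; exact: (@proj_continuous _ (fun=> 'cV[R]_d : topologicalType)).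
by apply/funext => f; rewrite mxE.
Qed.

Lemma transport_token_set_bound :
  exists B, forall M M', token_set M -> token_set M' -> transport lambda M M' <= B.
Proof.
have : compact ((fun p => transport lambda p.1 p.2) @` (token_set `*` token_set)).
  apply: continuous_compact; last by apply: compact_setX; exact: token_set_compact.
  apply: continuous_subspaceT.
  apply: transport_continuous => //; [exact: fst_cont|exact: snd_cont].
move=> /compact_bounded [B [_ hB]]; exists (B + 1) => M M' hM hM'.
apply: (le_trans (ler_norm _)); apply: (hB (B + 1)); rewrite ?ltrDl//.
by exists (M, M').
Qed.

Definition cost_bound := projT1 (cid transport_token_set_bound).

Lemma cost_boundP M M' : token_set M -> token_set M' ->
  transport lambda M M' <= cost_bound.
Proof. exact: (projT2 (cid transport_token_set_bound)). Qed.

Lemma cost_bound_ge0 : 0 <= cost_bound.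
Proof.
have [x _] : [set: 'I_N -> subT hS] !=set0 by exists (fun=> point).
apply: (le_trans (transport_ge0 hN hlambda (token_mx x) (token_mx x))).
by apply: cost_boundP; exists x.
Qed.

(* Truncation makes the cost bounded off the token configurations. *)
Definition run_cost (u : controls) (p : 'M[R]_(d, N) * 'M[R]_(d, N)) : R :=
  Num.min (transport lambda (token_iter beta sigma u (enum 'I_T) p.1) p.2) cost_bound.

Lemma run_cost_continuous (W : topologicalType) (u : W -> controls) p :
  continuous u -> continuous p -> continuous (fun w => run_cost (u w) (p w)).
Proof.
move=> cu cp; apply: rcont_min; last exact: rcont_cst.
apply: transport_continuous => //; last exact: (comp_cont cp (@snd_cont _ _)).
apply: token_iter_cont => //; last exact: (comp_cont cp (@fst_cont _ _)).
by move=> i; exact: (comp_cont cu (@proj_continuous _ (fun=> act) i)).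
Qed.

Definition baries (z : Z) := (bary z.1, bary z.2).

Lemma baries_continuous : continuous baries.
Proof.
apply: pair_cont.
- exact: (comp_cont (@fst_cont _ _) (bary_continuous hScompact)).
- exact: (comp_cont (@snd_cont _ _) (bary_continuous hScompact)).
Qed.

Lemma bcont_run_cost u : bcont (fun z : Z => run_cost u (baries z)).
Proof.
split; first by apply: run_cost_continuous; [exact: cst_continuous|exact: baries_continuous].
exists cost_bound => z; rewrite ger0_norm /run_cost ?ge_min ?lexx ?orbT//.
by rewrite le_min cost_bound_ge0 transport_ge0.
Qed.

Definition token_pairs : set (borel Z) := [set z | defect z.1 + defect z.2 = 0].

Lemma defect2_continuous : continuous (fun z : Z => defect z.1 + defect z.2).
Proof.
apply: rcontD.
- exact: (comp_cont (@fst_cont _ _) (defect_continuous hScompact)).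
- exact: (comp_cont (@snd_cont _ _) (defect_continuous hScompact)).
Qed.

Lemma token_pairs_measurable : measurable token_pairs.
Proof.
apply: (@borel_closed Z).
apply: (@closed_comp _ _ (fun z : Z => defect z.1 + defect z.2) [set 0]).
  by move=> z _; exact: defect2_continuous.
by apply: accessible_closed_set1; apply: hausdorff_accessible; exact: Rhausdorff.
Qed.

Lemma token_pairsP z : token_pairs z -> exists x y, is_tokens z.1 x /\ is_tokens z.2 y.
Proof.
move=> /eqP; rewrite paddr_eq0 ?defect_ge0// => /andP[/eqP /(defect_eq0 hScompact)[x zx]].
by move=> /eqP /(defect_eq0 hScompact)[y zy]; exists x, y.
Qed.

Lemma token_pairs_tokens mu nu x y : is_tokens mu x -> is_tokens nu y -> token_pairs (mu, nu).
Proof. by move=> mux nuy; rewrite /token_pairs/= (defect_tokens mux) (defect_tokens nuy) addr0. Qed.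

Lemma token_pairs_baries z : token_pairs z -> (token_set `*` token_set) (baries z).
Proof.
move=> /token_pairsP[x [y [zx zy]]].
by split; rewrite /= (bary_tokens zx) || rewrite /= (bary_tokens zy); eexists.
Qed.

(** Moves a tuple over the subtype [UU] into the product space of actions, where continuity in the
    control and Tychonoff's theorem apply. *)
Definition control_fun (U : T.-tuple UU) : controls := fun i => set_val (tnth U i).

Lemma foldl_control (U : T.-tuple UU) (M : 'M[R]_(d, N)) :
  foldl (fun M V => token_step beta sigma (set_val V) M) M U =
  token_iter beta sigma (control_fun U) (enum 'I_T) M.
Proof.
rewrite -[in LHS](map_tnth_enum U).
by elim: (enum 'I_T) M => [//|i s IH] M /=; exact: IH.
Qed.

(** Barycenters recover the tokens and the layers act on them by [token_iter]. The resulting matrix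
    is again a token matrix over [S], so the truncation at [cost_bound] is inactive. *)
Lemma W2_run_cost z (U : T.-tuple UU) : token_pairs z ->
  (W2 lambda (PhiT hf z.1 U) z.2 ^+ 2 = (run_cost (control_fun U) (baries z))%:E)%E.
Proof.
move=> /token_pairsP[x [y [zx zy]]].
have [x' zx' ex'] := foldl_Phi_tokens hsigma hf U zx.
rewrite (W2_tokens hlambda zx' zy); congr (_%:E).
rewrite /run_cost /= (bary_tokens zx) (bary_tokens zy) -foldl_control -ex'.
by apply/esym/min_idPl; apply: cost_boundP; eexists.
Qed.

Definition mean_cost (Q : Prob R Z) (u : controls) : R := \int[Q]_z run_cost u (baries z).

(** The integrand of [value] is not known to be measurable, but on the Borel set [token_pairs] of
    full measure it equals a bounded continuous function, so [integral_eq_off_null] applies. *)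
Lemma value_mean_cost (Q : Prob R Z) (U : T.-tuple UU) : Q (~` token_pairs) = 0%E ->
  value lambda hf Q U = (mean_cost Q (control_fun U))%:E.
Proof.
move=> Q0; rewrite /mean_cost /Rintegral fineK; last exact: (bcont_fin_num Q (bcont_run_cost _)).
apply: (integral_eq_off_null token_pairs_measurable Q0).
- by move=> z; rewrite expe2 mule_ge0 // poweR_ge0.
- by move=> z; rewrite lee_fin le_min cost_bound_ge0 transport_ge0.
- by apply/measurable_EFinP; exact: continuous_borelR (bcont_run_cost _).1.
- by move=> z; exact: W2_run_cost.
Qed.

(** The neighbourhood of [u] does not depend on [Q]: by joint continuity and compactness of the
    token matrices, [run_cost] moves by at most e for all token pairs at once, and [Q] charges
    nothing else. *)
Lemma mean_cost_equicontinuous (u : controls) (e : R) : 0 < e ->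
  \forall u' \near u, forall Q : Prob R Z, Q (~` token_pairs) = 0%E ->
    `|mean_cost Q u' - mean_cost Q u| <= e.
Proof.
move=> e0.
have cpt : compact (token_set `*` token_set) by apply: compact_setX; exact: token_set_compact.
have := (compact_near_coveringP _).1 cpt _ (nbhs u)
  (fun u' p => `|run_cost u' p - run_cost u p| <= e).
move=> /(_ _) H.
have : \forall u' \near u, (token_set `*` token_set) `<=`
    (fun p => `|run_cost u' p - run_cost u p| <= e).
  apply: H => p _.
  have c : continuous (fun q : ('M[R]_(d, N) * 'M[R]_(d, N)) * controls =>
      run_cost q.2 q.1 - run_cost u q.1).
    apply: rcontB; apply: run_cost_continuous.
    - exact: snd_cont.
    - exact: fst_cont.
    - exact: cst_continuous.
    - exact: fst_cont.
  have /cvgrPdist_le/(_ e e0) := c (p, u).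
  by apply: filterS => -[p' u'] /=; rewrite subrr sub0r normrN.
apply: filterS => u' hu' Q Q0.
rewrite /mean_cost -RintegralB//; last 2 first.
- exact: bcont_integrable (bcont_run_cost u').
- exact: bcont_integrable (bcont_run_cost u).
apply: (Rintegral_bound_ae token_pairs_measurable Q0).
- exact: bcontB (bcont_run_cost u') (bcont_run_cost u).
- exact: ltW.
- by move=> z /token_pairs_baries; exact: hu'.
Qed.

Lemma control_fun_UU U i : UU (control_fun U i).
Proof. exact: set_valP. Qed.

Lemma data_distribution_null (D : dataset N hS) :
  data_distribution hN D (~` token_pairs) = 0%E.
Proof.
rewrite empirical_atomic; last by apply: measurableC; exact: token_pairs_measurable.
rewrite big1// => k _; rewrite indicE memNset ?mulr0// => nt; apply: nt.
by apply: token_pairs_tokens; exact: empirical_atomic.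
Qed.

(** * Passage to the weak limit *)

Section Limit.
Variables (D : nat -> dataset N hS) (P : Prob R Z).
Hypothesis hP : (fun r => data_distribution hN (D r)) @ \oo --> P.

Lemma limit_Rintegral (g : Z -> R) : bcont g ->
  (fun r => \int[data_distribution hN (D r)]_z g z) @ \oo --> \int[P]_z g z.
Proof.
move=> bg; have c := @Rintegral_continuous R Z g bg P.
exact: (cvg_comp _ _ hP c).
Qed.

(** The total defect truncated at 1 is a bounded continuous test function with zero integral under
    every empirical distribution, hence under [P]. Being nonnegative, it vanishes almost surely, and
    its zero set is [token_pairs]. *)
Lemma limit_null : P (~` token_pairs) = 0%E.
Proof.
pose g (z : Z) := Num.min 1 (defect z.1 + defect z.2).
have g0 z : 0 <= g z by rewrite le_min ler01 addr_ge0 ?defect_ge0.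
have bg : bcont g.
  split; first by apply: rcont_min; [exact: rcont_cst|exact: defect2_continuous].
  by exists 1 => z; rewrite ger0_norm// ge_min lexx.
have E r : \int[data_distribution hN (D r)]_z g z = 0.
  rewrite (atomic_Rintegral _ (empirical_atomic _ _ _) bg.1).
    rewrite big1// => k _.
    suff : token_pairs (token_measure hN (data_input k), token_measure hN (data_output k)).
      by rewrite /g /token_pairs /= => ->; rewrite min_r ?ler01// mulr0.
    by apply: token_pairs_tokens; exact: empirical_atomic.
  by move=> _; rewrite invr_ge0.
have I0 : \int[P]_z g z = 0.
  have := limit_Rintegral bg; under eq_fun do rewrite E.
  by move=> /(cvg_unique (@Rhausdorff R) (cvg_cst (0 : R))).
have := Rintegral_eq0_null bg g0 I0; rewrite (_ : mkset _ = ~` token_pairs)//.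
apply/seteqP; split => z /=.
  by move=> /eqP gz zt; apply: gz; rewrite /g (zt : _ = 0) min_r.
move=> nz; apply/eqP => gz; apply: nz; move: gz; rewrite /g /token_pairs /= /Num.min.
by case: ltP => // _ /eqP; rewrite oner_eq0.
Qed.

(** Weak convergence handles one control at a time; equicontinuity extends the estimate to a
    neighbourhood of that control, and compactness of the controls makes it uniform. *)
Lemma mean_cost_uniform (e : R) : 0 < e -> \forall r \near \oo,
  forall u : controls, (forall i, UU (u i)) ->
    `|mean_cost (data_distribution hN (D r)) u - mean_cost P u| <= e.
Proof.
move=> e0; have e30 : 0 < e / 3 by rewrite divr_gt0.
have cpt : compact ([set u | forall i, UU (u i)] : set controls).
  by apply: (@tychonoff _ (fun=> act : topologicalType) (fun=> UU)) => _.
have := (compact_near_coveringP _).1 cpt _ \oo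
  (fun r u => `|mean_cost (data_distribution hN (D r)) u - mean_cost P u| <= e) _.
apply => u _.
have /cvgrPdist_le/(_ _ e30) cr := limit_Rintegral (bcont_run_cost u).
(* Three thirds of e: changing [u'] to [u] under the empirical distribution, the same change under
   [P], and the weak convergence at the fixed [u]. *)
exists ([set u' | forall Q : Prob R Z, Q (~` token_pairs) = 0%E ->
    `|mean_cost Q u' - mean_cost Q u| <= e / 3],
  [set r | `|mean_cost P u - mean_cost (data_distribution hN (D r)) u| <= e / 3]).
  by split => //=; exact: mean_cost_equicontinuous.
move=> [u' r] /= [h1 h2].
exact: (dist_le_third (h1 _ (data_distribution_null (D r))) (h1 _ limit_null) h2).
Qed.

End Limit.

End Value.

Theorem theorem13 (R : realType) (N d d1 d2 T : nat)
  (hN : (0 < N)%N) (hd : (0 < d)%N) (hd1 : (0 < d1)%N) (hd2 : (0 < d2)%N)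
  (hT : (0 < T)%N)
  (beta lambda : R) (hbeta : 0 < beta) (hlambda : 0 < lambda)
  (S : set 'cV[R]_d) (hS : S !=set0)
  (sigma : 'cV[R]_d1 -> 'cV[R]_d1) (hsigma : lipschitz1 sigma)
  (UU : set (action R d d1 d2)) (hUU : UU !=set0)
  (hf : layer_stable beta sigma hS hN UU)
  (hScompact : compact S) (hUcompact : compact UU)
  (D : nat -> dataset N hS)
  (P : Prob R (Prob R (XX hS hN) * Prob R (XX hS hN))%type)
  (hP : (fun r => data_distribution hN (D r)) @ \oo --> P)
  (Ur : nat -> T.-tuple UU)
  (hUr : forall r, value lambda hf (data_distribution hN (D r)) (Ur r)
                   = opt_value T lambda hf (data_distribution hN (D r)))
  (Ustar : T.-tuple UU)
  (hUstar : value lambda hf P Ustar = opt_value T lambda hf P) :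
  (fun r => value lambda hf P (Ur r)) @ \oo --> opt_value T lambda hf P.
Proof.
have P0 := limit_null hScompact hP.
have D0 r := data_distribution_null hN hScompact (D r).
have valueP U := value_mean_cost hsigma hlambda hScompact hf U P0.
have valueD r U := value_mean_cost hsigma hlambda hScompact hf U (D0 r).
(* All values are finite means, so the convergence in the extended reals reduces to one of real
   numbers. *)
rewrite -hUstar valueP; under eq_fun do rewrite valueP.
apply: cvg_EFin; first by near=> r.
apply/cvgrPdist_le => e e0; have e20 : 0 < e / 2 by rewrite divr_gt0.
have unif := mean_cost_uniform T beta hsigma hlambda hScompact hUcompact hP e20.
apply: filterS unif => r unif_r /=.
have hu U := unif_r _ (@control_fun_UU _ _ _ _ T UU U).
(* Each optimality is used once, against the other control: [Ustar] beats [Ur r] for [P], and [Ur r]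
   beats [Ustar] for the empirical distribution. *)
have opt1 : (value lambda hf P Ustar <= value lambda hf P (Ur r))%E.
  by rewrite hUstar; apply: ereal_inf_lbound; exists (Ur r).
have opt2 : (value lambda hf (data_distribution hN (D r)) (Ur r) <=
             value lambda hf (data_distribution hN (D r)) Ustar)%E.
  by rewrite hUr; apply: ereal_inf_lbound; exists Ustar.
rewrite !valueP lee_fin in opt1; rewrite !valueD lee_fin in opt2.
exact: (min_dist_le opt1 opt2 (hu (Ur r)) (hu Ustar)).
Unshelve. all: by end_near. Qed.
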